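(* There exists an automorphism of $P_3$ which cannot be lifted to an automorphism of $P_4$; that is, with respect to the extension $1\to U_4\to P_4\to P_3\to 1$, there exists $\phi\in\operatorname{Aut}(P_3)$ such that no automorphism of $P_4$ induces $\phi$ on $P_4/U_4\cong P_3$.
   Context: $B_n$ is the Artin braid group with standard generators $\sigma_1,\dots,\sigma_{n-1}$, and $P_n$ is the pure braid group, the kernel of $B_n\to S_n$, $\sigma_i\mapsto(i\ i+1)$. It is generated by $A_{i,j}=\sigma_{j-1}\cdots\sigma_{i+1}\sigma_i^2\sigma_{i+1}^{-1}\cdots\sigma_{j-1}^{-1}$, $1\le i<j\le n$. Let $U_4=\langle A_{1,4},A_{2,4},A_{3,4}\rangle\le P_4$, which is a free group of rank 3 and normal in $P_4$. One has $P_4=U_4\rtimes P_3$ with $P_3=\langle A_{1,2},A_{1,3},A_{2,3}\rangle$, and the map $P_4\to P_3$ is the projection with kernel $U_4$. An automorphism of $P_4$ induces (lifts) $\phi\in\operatorname{Aut}(P_3)$ if it preserves $U_4$ and the automorphism it induces on $P_4/U_4\cong P_3$ is $\phi$. *)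

(* Defs.v *)
From HB Require Import structures.
From mathcomp Require Import all_boot all_fingroup zify.
From mathcomp Require Import boolp classical_sets generic_quotient.

Set Implicit Arguments.
Unset Strict Implicit.
Unset Printing Implicit Defensive.

Local Open Scope classical_set_scope.
Local Open Scope quotient_scope.
Local Open Scope group_scope.

Section Presentation.
Variables (X : choiceType).

(* A letter (x, false) stands for x, and (x, true) for its inverse. *)
Definition word : Type := seq (X * bool).

Variable R : word -> word -> Prop.

Inductive pres_eq : word -> word -> Prop :=
| pres_eq_refl u : pres_eq u u
| pres_eq_sym u v : pres_eq u v -> pres_eq v u
| pres_eq_trans u v w : pres_eq u v -> pres_eq v w -> pres_eq u w
| pres_eq_cat u u' v v' :
    pres_eq u u' -> pres_eq v v' -> pres_eq (u ++ v) (u' ++ v')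
| pres_eq_inv x b : pres_eq [:: (x, b); (x, ~~ b)] [::]
| pres_eq_rel u v : R u v -> pres_eq u v.

Definition pres_eqb : rel (seq (X * bool)) := fun u v => `[< pres_eq u v >].

Lemma pres_eqb_refl : reflexive pres_eqb.
Proof. by move=> u; apply/asboolP; apply: pres_eq_refl. Qed.

Lemma pres_eqb_sym : symmetric pres_eqb.
Proof. by move=> u v; apply/asboolP/asboolP; apply: pres_eq_sym. Qed.

Lemma pres_eqb_trans : transitive pres_eqb.
Proof.
by move=> v u w /asboolP uv /asboolP vw; apply/asboolP; apply: pres_eq_trans vw.
Qed.

Canonical pres_equiv :=
  EquivRel pres_eqb pres_eqb_refl pres_eqb_sym pres_eqb_trans.

Definition pres : Type := {eq_quot pres_equiv}.

HB.instance Definition _ := Choice.on pres.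
HB.instance Definition _ := EqQuotient.on pres.

Definition pres_class (u : word) : pres := \pi_pres u.

Lemma pres_classP u v : pres_class u = pres_class v <-> pres_eq u v.
Proof.
split; first by move=> /eqmodP /asboolP.
by move=> uv; apply/eqmodP/asboolP.
Qed.

Lemma pres_repr (u : word) : pres_eq (repr (pres_class u)) u.
Proof. by apply/pres_classP; rewrite /pres_class reprK. Qed.

Lemma pres_class_repr (x : pres) : pres_class (repr x) = x.
Proof. exact: reprK. Qed.

Definition word_inv (u : word) : word := rev [seq (l.1, ~~ l.2) | l <- u].

Lemma word_inv_cat u v : word_inv (u ++ v) = word_inv v ++ word_inv u.
Proof. by rewrite /word_inv map_cat rev_cat. Qed.

Lemma word_invK : involutive word_inv.
Proof.
move=> u; rewrite /word_inv map_rev revK -map_comp map_id_in //.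
by move=> [x b] _ /=; rewrite negbK.
Qed.

Lemma word_invL u : pres_eq (word_inv u ++ u) [::].
Proof.
elim: u => [|[x b] u IHu]; first exact: pres_eq_refl.
rewrite -[_ :: u]/([:: (x, b)] ++ u) word_inv_cat -catA.
apply: pres_eq_trans IHu; apply: pres_eq_cat; first exact: pres_eq_refl.
rewrite catA -[u in pres_eq _ u]/([::] ++ u).
apply: pres_eq_cat; last exact: pres_eq_refl.
by rewrite /word_inv /= -{2}[b]negbK; apply: pres_eq_inv.
Qed.

Lemma word_inv_eq u v : pres_eq u v -> pres_eq (word_inv u) (word_inv v).
Proof.
move=> uv.
have e1 : pres_eq (word_inv u ++ v) [::].
  apply: pres_eq_trans (word_invL u); apply: pres_eq_cat; first exact: pres_eq_refl.
  exact: pres_eq_sym.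
have e2 : pres_eq (v ++ word_inv v) [::].
  by have := word_invL (word_inv v); rewrite word_invK.
apply: (@pres_eq_trans _ (word_inv u ++ (v ++ word_inv v))).
  rewrite -{1}[word_inv u]cats0; apply: pres_eq_cat; first exact: pres_eq_refl.
  exact: pres_eq_sym.
rewrite catA -[X in pres_eq _ X]/([::] ++ word_inv v).
by apply: pres_eq_cat => //; apply: pres_eq_refl.
Qed.

Definition pres_one : pres := pres_class [::].
Definition pres_mul (x y : pres) : pres := pres_class (repr x ++ repr y).
Definition pres_inv (x : pres) : pres := pres_class (word_inv (repr x)).

Lemma pres_class_cat u v :
  pres_mul (pres_class u) (pres_class v) = pres_class (u ++ v).
Proof. by apply/pres_classP; apply: pres_eq_cat; apply: pres_repr. Qed.

Lemma pres_class_inv u : pres_inv (pres_class u) = pres_class (word_inv u).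
Proof. by apply/pres_classP; apply: word_inv_eq; apply: pres_repr. Qed.

Lemma pres_mulA : associative pres_mul.
Proof.
move=> x y z; rewrite -(pres_class_repr x) -(pres_class_repr y).
by rewrite -(pres_class_repr z) !pres_class_cat catA.
Qed.

Lemma pres_mul1 : left_id pres_one pres_mul.
Proof. by move=> x; rewrite -(pres_class_repr x) pres_class_cat. Qed.

Lemma pres_mulr1 : right_id pres_one pres_mul.
Proof. by move=> x; rewrite -(pres_class_repr x) pres_class_cat cats0. Qed.

Lemma pres_mulV : left_inverse pres_one pres_inv pres_mul.
Proof.
move=> x; rewrite -(pres_class_repr x) pres_class_inv pres_class_cat.
by apply/pres_classP; apply: word_invL.
Qed.

Lemma pres_mulrV : right_inverse pres_one pres_inv pres_mul.
Proof.
move=> x; rewrite -(pres_class_repr x) pres_class_inv pres_class_cat.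
by apply/pres_classP; have := word_invL (word_inv (repr x)); rewrite word_invK.
Qed.

HB.instance Definition _ := isGroup.Build pres
  pres_mulA pres_mul1 pres_mulr1 pres_mulV pres_mulrV.

End Presentation.

Section PresentationLift.
Variables (X : choiceType) (R : word X -> word X -> Prop) (G : groupType).
Variable f : X -> G.

Definition word_eval (u : word X) : G :=
  \prod_(l <- u) (if l.2 then (f l.1)^-1 else f l.1).

Hypothesis fR : forall u v, R u v -> word_eval u = word_eval v.

Lemma word_eval_eq u v : pres_eq R u v -> word_eval u = word_eval v.
Proof.
elim=> // {u v} [u v w _ -> _ ->|u u' v v' _ e _ e'|x b] //.
  by move: e e'; rewrite /word_eval !big_cat /= => -> ->.
rewrite /word_eval !big_cons big_nil mulg1 /=.
by case: b => /=; rewrite ?mulVg ?mulgV.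
Qed.

(* A homomorphism only under fR, on which its definition does not depend. *)
Definition pres_lift (x : pres R) : G := word_eval (repr x).

Lemma pres_lift_class u : pres_lift (pres_class R u) = word_eval u.
Proof. exact/word_eval_eq/pres_repr. Qed.

Lemma pres_liftM : {morph pres_lift : x y / x * y}.
Proof.
move=> x y; rewrite -(pres_class_repr x) -(pres_class_repr y).
rewrite [_ * _]pres_class_cat !pres_lift_class.
by rewrite /word_eval big_cat.
Qed.

Lemma pres_lift1 : pres_lift 1 = 1.
Proof. by rewrite pres_lift_class /word_eval big_nil. Qed.

End PresentationLift.

Section Braid.
Variable n : nat.

Definition gen : Type := {i : nat | 0 < i < n}.

HB.instance Definition _ := Choice.on gen.
HB.instance Definition _ := SubType.on gen.

Inductive braid_rel : word gen -> word gen -> Prop :=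
| braid_rel_comm (i j : gen) : (val i).+1 < val j ->
    braid_rel [:: (i, false); (j, false)] [:: (j, false); (i, false)]
| braid_rel_braid (i j : gen) : val j = (val i).+1 ->
    braid_rel [:: (i, false); (j, false); (i, false)]
              [:: (j, false); (i, false); (j, false)].

Definition braid : Type := pres braid_rel.
HB.instance Definition _ := Group.on braid.

Definition braid_gen (i : gen) : braid := pres_class braid_rel [:: (i, false)].

(* sigma i is the standard generator for 1 <= i <= n - 1; outside this range it
   is 1 by convention. *)
Definition sigma (i : nat) : braid := oapp braid_gen 1 (insub i).

(* The strands 1, ..., n are represented by 0, ..., n - 1 in 'I_n, so that
   (i  i+1) becomes the transposition of i - 1 and i. *)
Lemma gen_lt (i : gen) : val i < n.
Proof. by case/andP: (valP i). Qed.

Lemma gen_pred_lt (i : gen) : (val i).-1 < n.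
Proof. exact: leq_ltn_trans (leq_pred _) (gen_lt i). Qed.

Definition gen_perm (i : gen) : 'S_n :=
  tperm (Ordinal (gen_pred_lt i)) (Ordinal (gen_lt i)).

Lemma tperm_braid (T : finType) (x y z : T) : x != y -> x != z -> y != z ->
  tperm x y * tperm y z * tperm x y = tperm y z * tperm x y * tperm y z.
Proof.
move=> xy xz yz.
have L : tperm x y * tperm y z * tperm x y = tperm x z.
  have -> : tperm x y * tperm y z * tperm x y = tperm y z ^ tperm x y.
    by rewrite /conjg tpermV mulgA.
  by rewrite tpermJ tpermR tpermD.
rewrite L.
have -> : tperm y z * tperm x y * tperm y z = tperm x y ^ tperm y z.
  by rewrite /conjg tpermV mulgA.
by rewrite tpermJ tpermL tpermD // eq_sym.
Qed.

Lemma gen_perm_rel u v :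
  braid_rel u v -> word_eval gen_perm u = word_eval gen_perm v.
Proof.
case=> [] [i hi] [j hj] /= ij; rewrite /word_eval !big_cons big_nil !mulg1 /=.
  rewrite /gen_perm; set a := Ordinal _; set b := Ordinal _.
  set c := Ordinal _; set d := Ordinal _.
  suff: tperm c d ^ tperm a b = tperm c d.
    by move=> e; rewrite -{1}e /conjg mulVKg.
  have [ac ad bc bd] : [/\ a != c, a != d, b != c & b != d].
    by split; rewrite -val_eqE /=; move/andP: (hi) => []; lia.
  by rewrite tpermJ !tpermD.
have [ij1 hj0] : j.-1 = i /\ i.-1 != i by move/andP: (hi) => []; lia.
rewrite /gen_perm /= !mulgA.
set a := Ordinal _; set b := Ordinal _; set c := Ordinal _; set d := Ordinal _.
have -> : c = b by apply: val_inj.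
by apply: tperm_braid; rewrite -val_eqE /=; lia.
Qed.

Definition braid_perm : braid -> 'S_n := pres_lift gen_perm.

Lemma braid_permM : {morph braid_perm : x y / x * y}.
Proof. exact: pres_liftM gen_perm_rel. Qed.

Lemma braid_perm1 : braid_perm 1 = 1.
Proof. exact: pres_lift1 gen_perm_rel. Qed.

HB.instance Definition _ := isUMagmaMorphism.Build braid 'S_n braid_perm
  (braid_perm1, braid_permM).

Definition pure : {pred braid} := [pred b | braid_perm b == 1].

Lemma pure_group_closed : group_closed pure.
Proof.
split; first by rewrite inE gmulf1.
move=> x y; rewrite !inE => /eqP px /eqP py.
by rewrite gmulfF /= px py divg1.
Qed.

HB.instance Definition _ := isMulClosed.Build braid pure
  (group_closedM pure_group_closed).
HB.instance Definition _ := isMul1Closed.Build braid pure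
  (proj1 pure_group_closed).
HB.instance Definition _ := isInvClosed.Build braid pure
  (group_closedV pure_group_closed).

Definition pure_braid : Type := {b : braid | b \in pure}.
HB.instance Definition _ := SubChoice.on pure_braid.
HB.instance Definition _ := SubChoice_isSubGroup.Build braid pure pure_braid
  pure_group_closed.

(* sigma_(j-1) ... sigma_(i+1), the indices decreasing from left to right *)
Definition braid_A_conj (i j : nat) : braid :=
  \prod_(k <- rev (iota i.+1 (j - i.+1))) sigma k.

Definition braid_A (i j : nat) : braid :=
  braid_A_conj i j * sigma i ^+ 2 * (braid_A_conj i j)^-1.

Lemma braid_perm_sigma2 i : braid_perm (sigma i ^+ 2) = 1.
Proof.
rewrite gmulfXn /sigma; case: insubP => [s _ _|_] /=; last by rewrite gmulf1 expg1n.
rewrite /braid_perm (pres_lift_class gen_perm_rel) /word_eval big_cons big_nil.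
by rewrite mulg1 expgS expg1 /gen_perm tperm2.
Qed.

Lemma braid_A_pure i j : braid_A i j \in pure.
Proof. by rewrite inE 2!braid_permM braid_perm_sigma2 mulg1 -braid_permM mulgV gmulf1. Qed.

Definition pure_A (i j : nat) : pure_braid :=
  exist (fun b => b \in pure) (braid_A i j) (braid_A_pure i j).

End Braid.

Section StrandInclusion.
Variable n : nat.

Lemma strand_incl_rel u v : @braid_rel n u v ->
  word_eval (fun i : gen n => sigma n.+1 (val i)) u =
  word_eval (fun i : gen n => sigma n.+1 (val i)) v.
Proof.
have sE (i : gen n) : exists2 i' : gen n.+1, val i' = val i &
    sigma n.+1 (val i) = braid_gen i'.
  rewrite /sigma; case: insubP => [i' _ e|]; first by exists i'.
  by case/andP: (valP i) => -> /ltnW; rewrite ltnS => ->.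
case=> i j; have [i' ei si] := sE i; have [j' ej sj] := sE j;
  rewrite -ei -ej => ij; rewrite /word_eval !big_cons big_nil /= si sj !mulg1.
- have /pres_eq_rel/pres_classP := braid_rel_comm ij.
  rewrite -[[:: _; _]]/([:: _] ++ [:: _]) -[[:: _; _] in RHS]/([:: _] ++ [:: _]).
  by rewrite -!pres_class_cat.
- have /pres_eq_rel/pres_classP := braid_rel_braid ij.
  rewrite -[[:: _; _; _]]/([:: _] ++ [:: _] ++ [:: _]).
  rewrite -[[:: _; _; _] in RHS]/([:: _] ++ [:: _] ++ [:: _]).
  by rewrite -!pres_class_cat.
Qed.

Definition braid_incl : braid n -> braid n.+1 :=
  pres_lift (fun i : gen n => sigma n.+1 (val i)).

Lemma braid_inclM : {morph braid_incl : x y / x * y}.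
Proof. exact: pres_liftM strand_incl_rel. Qed.

Lemma braid_incl1 : braid_incl 1 = 1.
Proof. exact: pres_lift1 strand_incl_rel. Qed.

HB.instance Definition _ :=
  isUMagmaMorphism.Build (braid n) (braid n.+1) braid_incl
    (braid_incl1, braid_inclM).

Lemma braid_perm_incl b :
  braid_perm (braid_incl b) = lift_perm ord_max ord_max (braid_perm b).
Proof.
rewrite -(pres_class_repr b); move: (repr b) => u.
rewrite /braid_incl (pres_lift_class strand_incl_rel).
rewrite /braid_perm (pres_lift_class (@gen_perm_rel n)) -/(@braid_perm n.+1).
rewrite /word_eval gmulf_prod.
rewrite (big_morph (lift_perm ord_max ord_max) (id1 := 1) (op1 := *%g)); last 2 first.
- by move=> s t; rewrite lift_permM.
- by rewrite lift_perm1.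
apply: eq_bigr => -[i b'] _ /=.
suff e : braid_perm (sigma n.+1 (val i)) = lift_perm ord_max ord_max (gen_perm i).
  by case: b'; rewrite ?gmulfV /= e ?lift_permV.
rewrite /sigma; case: insubP => [i' _ ei|] /=; last first.
  by case/andP: (valP i) => -> /ltnW; rewrite ltnS => ->.
rewrite /braid_perm (pres_lift_class (@gen_perm_rel n.+1)) /word_eval.
rewrite big_cons big_nil mulg1 /=.
have -> : gen_perm i' = tperm (lift ord_max (Ordinal (gen_pred_lt i)))
                              (lift ord_max (Ordinal (gen_lt i))).
  by rewrite /gen_perm; congr tperm; apply: val_inj; rewrite /= /bump leqNgt ?gen_lt ?gen_pred_lt ?ei;
    have := gen_lt i; have := gen_pred_lt i.
apply/permP => k; case: (unliftP ord_max k) => [k'|] ->.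
  by rewrite lift_perm_lift /gen_perm (inj_tperm _ _ _ lift_inj).
by rewrite lift_perm_id tpermD // eq_sym neq_lift.
Qed.

Lemma pure_incl_subproof (b : pure_braid n) : braid_incl (val b) \in @pure n.+1.
Proof.
by rewrite inE braid_perm_incl; case: b => b /= /eqP->; rewrite lift_perm1.
Qed.

Definition pure_incl (b : pure_braid n) : pure_braid n.+1 :=
  exist (fun b => b \in @pure n.+1) (braid_incl (val b))
    (pure_incl_subproof b).

Lemma pure_inclM : {morph pure_incl : x y / x * y}.
Proof. by move=> x y; apply: val_inj; apply: braid_inclM. Qed.

HB.instance Definition _ :=
  isMultiplicative.Build (pure_braid n) (pure_braid n.+1) pure_incl pure_inclM.

End StrandInclusion.

Definition is_subgroup (G : groupType) (H : set G) : Prop :=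
  [/\ H 1, forall x y, H x -> H y -> H (x * y) & forall x, H x -> H x^-1].

Definition subgroup_gen (G : groupType) (S : set G) : set G :=
  smallest (@is_subgroup G) S.

Definition left_coset (G : groupType) (H : set G) (x : G) : set G :=
  [set x * h | h in H].

(* For U := last_strand n, the pure braid group on n + 1 strands is the
   semidirect product of U and the image of pure_incl. *)
Definition last_strand (n : nat) : set (pure_braid n.+1) :=
  subgroup_gen [set pure_A n.+1 i n.+1 | i in [set i | 0 < i < n.+1]].

Arguments last_strand : clear implicits.

(* The pure braid group on n strands is identified with the quotient by
   U := last_strand n through x |-> pure_incl x U, which is inverse to the
   isomorphism given by the projection with kernel U.  If Phi preserves U, it
   acts on the quotient by y U |-> Phi y U; this action is required to be phi. *)
Definition induces (n : nat) (Phi : pure_braid n.+1 -> pure_braid n.+1)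
    (phi : pure_braid n -> pure_braid n) : Prop :=
  Phi @` last_strand n = last_strand n /\
  forall x : pure_braid n,
    left_coset (last_strand n) (Phi (pure_incl x)) =
    left_coset (last_strand n) (pure_incl (phi x)).

(* Main.v *)
Require Import Defs.
From HB Require Import structures.
From mathcomp Require Import all_boot all_fingroup all_algebra zify ring.
From mathcomp Require Import boolp classical_sets generic_quotient.

Set Implicit Arguments.
Unset Strict Implicit.
Unset Printing Implicit Defensive.

Import GRing.Theory.
Local Open Scope group_scope.

(** Characters of the pure braid group with values in F_3 are used.  A pair of
    characters of a group G may or may not be the first two coordinates of a
    homomorphism from G to the Heisenberg group over F_3, that is, have trivial
    cup product; automorphisms of G preserve this property.  If it holds for a
    pair, then commuting elements of G are sent to proportional vectors of
    F_3^2 ([heis_commute]).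

    For G = P_4 a character is a vector of six values, one on each A_ij, because
    the A_ij generate ([pure_braid_generated]).  The commuting pairs at hand are
    A_12, A_34 with their conjugates, and the full twist of three strands
    i < j < k together with A_ij and A_ik.  They confine every character of a
    linearly independent liftable pair to one of five planes: four of the form
    (sum zero, supported on the pairs inside {i, j, k}), and the sum-zero plane
    of the vectors that agree on complementary pairs ([resonanceP]).  The four
    planes of the first kind do consist of such characters: forget one strand,
    and map P_3, which is F_2 x Z ([F2Z_of_pureK], [pure_of_F2ZK]), to the
    Heisenberg group through F_2.

    Write x_ij for the character dual to A_ij.  The character x_13 - x_12 kills
    U_4, and it is the difference of x_14 - x_12, from the plane of {1, 2, 4},
    and x_14 - x_13, from the plane of {1, 3, 4}; neither of these kills U_4.
    If an automorphism Phi of P_4 preserves U_4 and induces phi on the quotient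
    P_3, then (x_13 - x_12) o phi, extended by zero to U_4, is again a
    difference of two characters from the five planes that do not kill U_4.

    Let phi be the automorphism of P_3 = F_2 x Z that fixes the centre and A_13
    and sends A_23 to A_23 A_13.  Then (x_13 - x_12) o phi is
    x_12 + x_13 + x_23 modulo 3, and this is not such a difference
    ([resonance_shift]).  Geometrically, the plane of {1, 2, 3} contains three
    distinguished lines, cut out by sums of two of the other four planes; a
    lift would make phi permute them, which this transvection does not. *)

(** * Homomorphisms, generated subgroups, presentations, characters *)

Lemma mulhom1 (G H : groupType) (f : G -> H) :
  {morph f : x y / x * y} -> f 1 = 1.
Proof. by move=> fM; apply: (mulgI (f 1)); rewrite -fM !mulg1. Qed.

Lemma mulhomV (G H : groupType) (f : G -> H) :
  {morph f : x y / x * y} -> {morph f : x / x^-1}.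
Proof.
by move=> fM x; apply: (mulgI (f x)); rewrite -fM !mulgV (mulhom1 fM).
Qed.

Lemma commute_conj (G : groupType) (z x y : G) : commute z x -> commute z y ->
  commute z (x ^ y).
Proof. by move=> zx zy; rewrite conjgE; do !apply: commuteM => //; apply: commuteV. Qed.

Lemma commuteJ (G : groupType) (x y z : G) : commute x y -> commute (x ^ z) (y ^ z).
Proof. by rewrite /commute -!conjMg => ->. Qed.

Definition commute2 (G : groupType) (z x y : G) := commute z x /\ commute z y.

Lemma commute2J (G : groupType) (z x y g : G) :
  commute2 z x y -> commute2 (z ^ g) (x ^ g) (y ^ g).
Proof. by case=> *; split; apply: commuteJ. Qed.

(** Reduces the invariance of a generated subgroup under a conjugation to its
    generators. *)
Lemma is_subgroup_preim_conj (G : groupType) (H : set G) y :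
  is_subgroup H -> is_subgroup [set x | H (x ^ y)].
Proof.
move=> [H1 HM HV]; split=> [|x z|x] /=; first by rewrite conj1g.
- by rewrite conjMg; apply: HM.
- by rewrite conjVg; apply: HV.
Qed.

Section SubgroupGen.
Variables (G : groupType) (S : set G).
Local Open Scope classical_set_scope.

Lemma subgroup_gen_subgroup : is_subgroup (subgroup_gen S).
Proof.
split=> [H [[] ] //|x y Sx Sy H HS|x Sx H HS].
  by case: (HS) => -[_ + _] _; apply; [apply: Sx|apply: Sy].
by case: (HS) => -[_ _ +] _; apply; apply: Sx.
Qed.

Lemma mem_subgroup_gen x : S x -> subgroup_gen S x.
Proof. by move=> Sx H [_]; apply. Qed.

Lemma subgroup_gen_sub (P : set G) :
  is_subgroup P -> S `<=` P -> subgroup_gen S `<=` P.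
Proof. by move=> PG SP x; apply. Qed.

End SubgroupGen.

Section PresInduction.
Variables (X : choiceType) (R : word X -> word X -> Prop).

Definition pres_gen (x : X) : pres R := pres_class R [:: (x, false)].

Lemma pres_ind (P : pres R -> Prop) :
    P 1 -> (forall y x, P y -> P (y * pres_gen x)) ->
    (forall y x, P y -> P (y * (pres_gen x)^-1)) ->
  forall y, P y.
Proof.
move=> P1 PM PV y; rewrite -(pres_class_repr y).
elim/last_ind: (repr y) => [|u [x e] IHu] //.
rewrite -cats1 -pres_class_cat; case: e; last exact: PM.
suff -> : pres_class R [:: (x, true)] = (pres_gen x)^-1 by apply: PV.
exact/esym/pres_class_inv.
Qed.

Lemma pres_hom_eq (G : groupType) (f g : pres R -> G) :
    {morph f : x y / x * y} -> {morph g : x y / x * y} ->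
  (forall x, f (pres_gen x) = g (pres_gen x)) -> f =1 g.
Proof.
move=> fM gM fg; elim/pres_ind => [|y x IH|y x IH].
- by rewrite (mulhom1 fM) (mulhom1 gM).
- by rewrite fM gM IH fg.
- by rewrite fM gM (mulhomV fM) (mulhomV gM) IH fg.
Qed.

End PresInduction.

Section Additive.
Variables (G : groupType) (V : zmodType).
Local Open Scope ring_scope.

Definition additive_char (chi : G -> V) := forall x y : G, chi (x * y)%g = chi x + chi y.

Variable chi : G -> V.
Hypothesis chiM : additive_char chi.

Lemma char1 : chi 1%g = 0.
Proof. by apply: (addrI (chi 1%g)); rewrite -chiM mulg1 addr0. Qed.

Lemma charV x : chi x^-1%g = - chi x.
Proof. by apply: (addrI (chi x)); rewrite -chiM mulgV char1 subrr. Qed.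

Lemma charJ x y : chi (x ^ y)%g = chi x.
Proof. by rewrite conjgE !chiM charV addrCA addNr addr0. Qed.

Lemma char_ker_subgroup : is_subgroup [set x | chi x = 0]%classic.
Proof.
split=> [|x y /= x0 y0|x /= x0]; first exact: char1.
- by rewrite chiM x0 y0 addr0.
- by rewrite charV x0 oppr0.
Qed.

End Additive.

(** * Generators of the braid groups *)

Section BraidGenerators.
Variable n : nat.
Implicit Types (b : braid n) (i j k : nat).

Lemma sigma_out i : ~~ (0 < i < n) -> sigma n i = 1.
Proof. by move=> hi; rewrite /sigma insubN. Qed.

Lemma sigma_in i (hi : 0 < i < n) :
  sigma n i = braid_gen (exist (fun k => 0 < k < n) i hi).
Proof. by rewrite /sigma insubT. Qed.

(** The convention that sigma is 1 out of range keeps this valid for all indices,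
    while the braid relation below would fail when only one index is in range. *)
Lemma sigma_comm i j : i.+1 < j -> commute (sigma n i) (sigma n j).
Proof.
move=> ij; case: (boolP (0 < i < n)) => hi; last first.
  by rewrite (sigma_out hi); apply/commute_sym/commute1.
case: (boolP (0 < j < n)) => hj; last by rewrite (sigma_out hj); apply: commute1.
rewrite /commute (sigma_in hi) (sigma_in hj) /braid_gen.
set x := exist _ i hi; set y := exist _ j hj.
have xy : (val x).+1 < val y by [].
rewrite [LHS]pres_class_cat [RHS]pres_class_cat; apply/pres_classP/pres_eq_rel.
exact: (braid_rel_comm xy).
Qed.

Lemma sigma_braid i : 0 < i -> i.+1 < n ->
  sigma n i * sigma n i.+1 * sigma n i = sigma n i.+1 * sigma n i * sigma n i.+1.
Proof.
move=> i0 iN.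
have hi : 0 < i < n by rewrite i0 ltnW.
have hj : 0 < i.+1 < n by [].
rewrite (sigma_in hi) (sigma_in hj) /braid_gen.
set x := exist _ i hi; set y := exist _ i.+1 hj.
have xy : val y = (val x).+1 by [].
pose cl : word (gen n) -> braid n := pres_class (@braid_rel n).
have E u v w : cl u * cl v * cl w = cl (u ++ v ++ w).
  by rewrite [X in X * _]pres_class_cat [LHS]pres_class_cat catA.
by rewrite [LHS]E [RHS]E; apply/pres_classP/pres_eq_rel/(braid_rel_braid xy).
Qed.

Lemma braid_ind (P : braid n -> Prop) :
    P 1 ->
    (forall b i, 0 < i < n -> P b -> P (b * sigma n i)) ->
    (forall b i, 0 < i < n -> P b -> P (b * (sigma n i)^-1)) ->
  forall b, P b.
Proof.
move=> P1 PM PV b; elim/pres_ind: b => [|b [i hi] Pb|b [i hi] Pb] //.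
- by have := PM _ _ hi Pb; rewrite (sigma_in hi).
- by have := PV _ _ hi Pb; rewrite (sigma_in hi).
Qed.

Lemma braid_perm_sigma i (x : 'I_n) : 0 < i < n ->
  braid_perm (sigma n i) x =
    (if x == i.-1 :> nat then i else if x == i :> nat then i.-1 else x) :> nat.
Proof.
move=> hi; rewrite (sigma_in hi) /braid_perm (pres_lift_class (@gen_perm_rel n)).
rewrite /word_eval big_cons big_nil mulg1 /= /gen_perm permE /= -!val_eqE /=.
by case: ifP => // _; case: ifP.
Qed.

End BraidGenerators.

Section BraidTriple.
Variables (G : groupType) (x y : G).
Hypothesis xy : x * y * x = y * x * y.

Lemma braid_conj : y ^ x^-1 = x ^ y.
Proof.
apply: (mulgI y); apply: (mulIg x).
by rewrite !conjgE invgK !mulgA mulgVK mulgV mul1g xy.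
Qed.

Lemma braid_conj2 : x ^ (x * y)^-1 = y.
Proof. by rewrite conjgE invgK mulgA xy -[y * x * y]mulgA mulgK. Qed.

(** With x, y the generators of the braid group on three strands, the left-hand
    side is A_13 A_23 A_12, and x y x is the half twist, whose conjugation
    exchanges x and y; hence its square is central. *)
Lemma full_twistE : (x ^+ 2) ^ y^-1 * y ^+ 2 * x ^+ 2 = (x * y * x) ^+ 2.
Proof.
rewrite !expg2 conjgE invgK !mulgA mulgVK -[y * x * x * y * x]mulgA.
by rewrite -[y * x * x * (y * x)]mulgA (mulgA x y x) xy !mulgA -xy.
Qed.

Let half_twist_l : x * (x * y * x) = (x * y * x) * y.
Proof. by rewrite {1}xy !mulgA. Qed.

Let half_twist_r : y * (x * y * x) = (x * y * x) * x.
Proof. by rewrite {2}xy !mulgA. Qed.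

Lemma full_twist_comm_l : commute ((x * y * x) ^+ 2) x.
Proof.
by rewrite /commute expg2 -mulgA -half_twist_r mulgA -half_twist_l -mulgA.
Qed.

Lemma full_twist_comm_r : commute ((x * y * x) ^+ 2) y.
Proof.
by rewrite /commute expg2 -mulgA -half_twist_l mulgA -half_twist_r -mulgA.
Qed.

End BraidTriple.

Lemma braid_A_right n i j : i < j -> braid_A n i j.+1 = braid_A n i j ^ (sigma n j)^-1.
Proof.
move=> ij; rewrite /braid_A /braid_A_conj subSS.
have -> : j - i = (j - i.+1).+1 by lia.
rewrite -{1 2}[(j - i.+1).+1]addn1 iotaD rev_cat big_cat /= big_seq1.
have -> : i.+1 + (j - i.+1) = j by lia.
by rewrite conjgE invgK invMg !mulgA.
Qed.

Lemma braid_A_adjacent n i : braid_A n i i.+1 = sigma n i ^+ 2.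
Proof. by rewrite /braid_A /braid_A_conj subnn big_nil invg1 mul1g mulg1. Qed.

(** * The pure braid group is generated by the A_ij *)

Section LastStrand.
Variable n : nat.
Local Open Scope classical_set_scope.
Local Notation s := (sigma n.+1).
Local Notation T k := (braid_A_conj n.+1 k n.+1).
Local Notation A k := (braid_A n.+1 k n.+1).

Lemma transversalS k : k < n -> T k = T k.+1 * s k.+1.
Proof.
move=> kn; rewrite /braid_A_conj !subSS.
have -> : n - k = (n - k.+1).+1 by lia.
by rewrite /= rev_cons -cats1 big_cat /= big_seq1.
Qed.

Lemma transversal_last : T n = 1.
Proof. by rewrite /braid_A_conj subnn big_nil. Qed.

Lemma transversal_ind (P : nat -> Prop) :
  P n -> (forall k, k < n -> P k.+1 -> P k) -> forall k, k <= n -> P k.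
Proof.
move=> Pn PS k kn; rewrite -(subKn kn).
elim: (n - k) (leq_subr k n) => [|d IHd] dn; first by rewrite subn0.
by apply: PS; [lia|rewrite -subSn // subSS; apply: IHd; lia].
Qed.

Lemma transversal_comm j k : j < k <= n -> commute (s j) (T k).
Proof.
move=> /andP[jk kn]; elim/transversal_ind: k / kn jk => [|k kn IHk] jk.
  by rewrite transversal_last; apply: commute1.
rewrite transversalS //; apply: commuteM; first by apply: IHk; lia.
exact: sigma_comm.
Qed.

(** A crossing of the strands j and j + 1 slides through the representative,
    which carries the last strand over to position k + 1 and moves the
    strands that it passes up by one. *)
Lemma transversal_shift j k : 0 < j -> k < j < n -> T k * s j.+1 = s j * T k.
Proof.
move=> j0 /andP[kj jn]; have kn : k <= n by lia.
elim/transversal_ind: k / kn kj => [|k kn IHk] kj; first by lia.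
rewrite transversalS //; have [jE|jE] := eqVneq j k.+1; last first.
  rewrite mulgA -IHk; last by lia.
  by rewrite -!mulgA (sigma_comm n.+1 (_ : k.+2 < j.+1)) //; lia.
rewrite -jE transversalS; last by lia.
rewrite -!mulgA [s j.+1 * _]mulgA -sigma_braid //.
by rewrite !mulgA -transversal_comm //; lia.
Qed.

Lemma braid_AE k : A k = (s k ^+ 2) ^ (T k)^-1.
Proof. by rewrite conjgE invgK mulgA. Qed.

Lemma transversal_sigma k : 0 < k <= n -> T k.-1 = T k * s k.
Proof. by case: k => // k /= kn; rewrite transversalS. Qed.

(** This and the next two lemmas say how sigma_j, for j < n, acts by conjugation
    on the generators of U; together they give that the image of the braid group
    on n strands normalizes U. *)
Lemma conj_A_up k : 0 < k < n -> A k ^ (s k)^-1 = A k.+1.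
Proof.
move=> /andP[k0 kn]; rewrite !braid_AE -conjgM -invMg transversalS // mulgA.
have -> : s k * T k.+1 = T k.+1 * s k by apply: transversal_comm; lia.
rewrite -mulgA invMg [LHS]conjgM; congr (_ ^ _).
by rewrite conjXg braid_conj2 //; apply: sigma_braid.
Qed.

Lemma conj_A_down k : 0 < k < n -> A k.+1 ^ (s k)^-1 = A k ^ A k.+1.
Proof.
move=> /andP[k0 kn].
have -> : A k ^ A k.+1 = A k ^ (T k.+1 * (s k.+1 * s k.+1) * (T k.+1)^-1) by [].
rewrite !braid_AE -!conjgM -invMg.
have -> : s k * T k.+1 = T k.+1 * s k by apply: transversal_comm; lia.
rewrite (transversalS kn).
rewrite !invMg !mulgA mulgVK mulVg mul1g.
rewrite [LHS]conjgM [RHS]conjgM; congr (_ ^ _).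
by rewrite !conjXg braid_conj //; apply: sigma_braid => //; lia.
Qed.

Lemma conj_A_fix j k : 0 < j < n -> 0 < k <= n -> j != k -> j.+1 != k ->
  A k ^ (s j)^-1 = A k.
Proof.
move=> /andP[j0 jn] /andP[k0 kn] jk jk1; rewrite !braid_AE -conjgM -invMg.
have [ltjk|lekj] := ltnP j k.
  rewrite (transversal_comm (_ : j < k <= n)) ?ltjk // invMg conjgM.
  congr (_ ^ _); apply/conjg_fixP/commgP/commuteV/commute_sym/commuteX.
  by apply: sigma_comm; lia.
rewrite -transversal_shift //; last by lia.
rewrite invMg conjgM; congr (_ ^ _).
apply/conjg_fixP/commgP/commuteV/commute_sym/commuteX/commute_sym.
by apply: sigma_comm; lia.
Qed.

Definition last_strand_braid : set (braid n.+1) := val @` last_strand n.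
Local Notation U := last_strand_braid.

Lemma last_strand_braid_subgroup : is_subgroup U.
Proof.
have [U1 UM UV] := subgroup_gen_subgroup
  [set pure_A n.+1 i n.+1 | i in [set i | 0 < i < n.+1]].
split; first by exists 1.
- move=> _ _ [u Uu <-] [v Uv <-]; exists (u * v); [exact: UM|exact: valM].
- move=> _ [u Uu <-]; exists u^-1; [exact: UV|exact: gmulfV].
Qed.

Lemma last_strand_braid_A k : 0 < k <= n -> U (A k).
Proof. by move=> kn; exists (pure_A n.+1 k n.+1) => //; apply: mem_subgroup_gen; exists k. Qed.

Lemma last_strand_braid_ind (P : set (braid n.+1)) : is_subgroup P ->
  (forall k, 0 < k <= n -> P (A k)) -> U `<=` P.
Proof.
move=> [P1 PM PV] PA _ [u + <-]; move: u.
apply: (@subgroup_gen_sub _ _ [set u | P (val u)]); last first.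
  by move=> _ [k kn <-]; apply: PA.
split=> [|x y Px Py|x Px]; first exact: P1.
- by change (P (val x * val y)); apply: PM.
- by change (P (val x)^-1); apply: PV.
Qed.

(** Both signs are needed: a conjugation that maps U into itself need not map
    it onto itself. *)
Lemma last_strand_braid_conj_sigma j u : 0 < j < n -> U u ->
  U (u ^ (s j)^-1) /\ U (u ^ s j).
Proof.
have [U1 UM UV] := last_strand_braid_subgroup.
have UJ x y : U x -> U y -> U (x ^ y).
  by move=> Ux Uy; rewrite conjgE; apply: (UM _ _ (UV _ Uy)); apply: UM.
move=> jn Uu; split; move: u Uu; apply: last_strand_braid_ind.
- exact/is_subgroup_preim_conj/last_strand_braid_subgroup.
- move=> k kn /=; have [<-|jk] := eqVneq j k.
    by rewrite conj_A_up //; apply: last_strand_braid_A; lia.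
  have [jk1|jk1] := eqVneq j.+1 k; last first.
    by rewrite conj_A_fix //; apply: last_strand_braid_A.
  by rewrite -jk1 conj_A_down //; apply: UJ; apply: last_strand_braid_A; lia.
- exact/is_subgroup_preim_conj/last_strand_braid_subgroup.
- have down : A j.+1 ^ s j = A j by rewrite -conj_A_up // conjgKV.
  move=> k kn /=; have [<-|jk] := eqVneq j k.
    (* conj_A_down, conjugated back by s j, where A j.+1 ^ s j = A j. *)
    have -> : A j ^ s j = A j.+1 ^ (A j)^-1.
      apply: (canRL (conjgK (A j))).
      by rewrite -{2}down -conjJg -conj_A_down // conjgKV.
    apply: UJ; last apply: UV; apply: last_strand_braid_A; lia.
  have [<-|jk1] := eqVneq j.+1 k.
    by rewrite down; apply: last_strand_braid_A; lia.
  by rewrite -(conj_A_fix jn kn jk jk1) conjgKV; apply: last_strand_braid_A.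
Qed.

Lemma braid_inclV : {morph @braid_incl n : x / x^-1}.
Proof. exact: gmulfV. Qed.

Lemma braid_permV m : {morph @braid_perm m : x / x^-1}.
Proof. exact: gmulfV. Qed.

Lemma braid_incl_sigma j : j < n -> braid_incl (sigma n j) = s j.
Proof.
move=> jn; have [-> | j0] := posnP j.
  by rewrite !sigma_out // braid_incl1.
have hj : 0 < j < n by rewrite j0.
rewrite (sigma_in hj) /braid_incl (pres_lift_class (@strand_incl_rel n)).
by rewrite /word_eval big_cons big_nil mulg1.
Qed.

Lemma last_strand_braid_conj (h : braid n) u : U u ->
  U (u ^ braid_incl h).
Proof.
move=> Uu; elim/braid_ind: h => [|h i hi|h i hi]; first by rewrite braid_incl1 conjg1.
- move=> IH; rewrite braid_inclM conjgM braid_incl_sigma; last by lia.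
  by have [] := last_strand_braid_conj_sigma hi IH.
- move=> IH; rewrite braid_inclM conjgM braid_inclV braid_incl_sigma; last by lia.
  by have [] := last_strand_braid_conj_sigma hi IH.
Qed.

(** The products T k = sigma_n ... sigma_(k+1) represent the right cosets of the
    subgroup of the braids that fix the last strand; that subgroup will turn out
    to be U times the image of the braid group on n strands.  Closure of this
    set of braids under right multiplication by generators is the Schreier
    argument that shows it to be everything. *)
Definition decomposable (b : braid n.+1) := exists u, exists h : braid n,
  exists k, [/\ U u, k <= n & b = u * braid_incl h * T k].

Lemma decomposableMl u h b : U u -> decomposable b ->
  decomposable (u * braid_incl h * b).
Proof.
have [_ UM UV] := last_strand_braid_subgroup.
move=> Uu [v [g [k [Uv kn ->]]]].
exists (u * v ^ (braid_incl h^-1)), (h * g), k; split=> //.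
  by apply: UM => //; apply: last_strand_braid_conj.
by rewrite braid_inclM braid_inclV conjgE invgK !mulgA mulgVK.
Qed.

Lemma decomposable_T k : k <= n -> decomposable (T k).
Proof.
move=> kn; exists 1, 1, k; split=> //; last by rewrite braid_incl1 !mul1g.
by case: last_strand_braid_subgroup.
Qed.

(** Four cases: sigma_j prolongs T k (j = k), closes the last strand around
    strand j and so produces an element of U (j = k + 1), or passes through T k
    as sigma_j (j < k) or sigma_(j-1) (j > k + 1). *)
Lemma decomposable_T_sigma k j : k <= n -> 0 < j < n.+1 ->
  decomposable (T k * s j) /\ decomposable (T k * (s j)^-1).
Proof.
have [U1 UM UV] := last_strand_braid_subgroup.
move=> kn /andP[j0 jn].
have Dincl h i : i <= n -> decomposable (braid_incl h * T i).
  by move=> hi; rewrite -[braid_incl h]mul1g; apply/decomposableMl/decomposable_T.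
have DU u i : U u -> i <= n -> decomposable (u * T i).
  move=> Uu hi; rewrite -[u]mulg1 -(@braid_incl1 n).
  exact/decomposableMl/decomposable_T.
have [jE|jk] := eqVneq j k.
  rewrite {}jE in j0 jn *.
  have E : T k * s k = T k.-1 by rewrite transversal_sigma //; lia.
  rewrite E; split; first by apply: decomposable_T; lia.
  have -> : T k * (s k)^-1 = (A k)^-1 * T k.-1.
    by rewrite -E /braid_A expg2 !invMg invgK !mulgA !mulgVK.
  by apply: DU; [apply: UV; apply: last_strand_braid_A|]; lia.
have [jk1|jk1] := eqVneq j k.+1.
  have E : T j * s j = T k by rewrite -transversal_sigma jk1 //; lia.
  split; last by rewrite -E mulgK; apply: decomposable_T; lia.
  have -> : T k * s j = A j * T j by rewrite -E /braid_A expg2 !mulgA mulgVK.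
  by apply: DU; [apply: last_strand_braid_A|]; lia.
have [i [ih Ei]] : exists i, i < n /\ T k * s j = s i * T k.
  have [jltk|] := ltnP j k.
    exists j; split; first by lia.
    by rewrite -transversal_comm ?jltk.
  move=> kj; exists j.-1; split; first by lia.
  by case: j j0 jn jk jk1 kj => // j *; rewrite -transversal_shift //; lia.
rewrite Ei -braid_incl_sigma //; split; first exact: Dincl.
have -> : T k * (s j)^-1 = (s i)^-1 * T k.
  by apply: (mulgI (s i)); apply: (mulIg (s j)); rewrite mulVKg !mulgA mulgVK Ei.
by rewrite -braid_incl_sigma // -braid_inclV; apply: Dincl.
Qed.

Lemma braid_decomposable b : decomposable b.
Proof.
elim/braid_ind: b => [|b j hj [u [h [k [Uu kn ->]]]]|b j hj [u [h [k [Uu kn ->]]]]].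
- by rewrite -transversal_last; apply: decomposable_T.
- rewrite -mulgA; apply: decomposableMl => //.
  by have [] := decomposable_T_sigma kn hj.
- rewrite -mulgA; apply: decomposableMl => //.
  by have [] := decomposable_T_sigma kn hj.
Qed.

Lemma braid_perm_transversal k : k <= n ->
  braid_perm (T k) ord_max = k :> nat.
Proof.
move=> kn; elim/transversal_ind: k / kn => [|k kn IHk].
  by rewrite transversal_last braid_perm1 perm1.
rewrite transversalS // braid_permM permM braid_perm_sigma ?IHk; last by lia.
by rewrite /= eqxx; case: eqP => //; lia.
Qed.

(** The coset representative of a pure braid is trivial, as the permutations of
    the different T k send the last strand to different places. *)
Theorem pure_split (x : pure_braid n.+1) : exists u y,
  last_strand n u /\ x = u * pure_incl y.
Proof.
have [_ [h [k [[u Uu <-] kn E]]]] := braid_decomposable (val x).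
have px : braid_perm (val x) = 1 by apply/eqP; case: (x).
have pu : braid_perm (val u) = 1 by apply/eqP; case: (u).
have kE : k = n.
  have := braid_perm_transversal kn; move/(congr1 (@braid_perm _)): E.
  rewrite px !braid_permM pu mul1g braid_perm_incl => /permP/(_ ord_max).
  by rewrite permM lift_perm_id perm1 => <-.
have ph : braid_perm h = 1.
  move/(congr1 (@braid_perm _)): E; rewrite kE transversal_last mulg1 px braid_permM pu mul1g.
  rewrite braid_perm_incl => /permP E; apply/permP => i.
  by have := E (lift ord_max i); rewrite lift_perm_lift !perm1 => /lift_inj <-.
have hp : h \in @pure n by rewrite inE ph.
exists u, (exist _ h hp); split=> //; apply: val_inj.
by rewrite E kE transversal_last mulg1.
Qed.

End LastStrand.

Lemma braid_incl_A n i j : i < j <= n -> braid_incl (braid_A n i j) = braid_A n.+1 i j.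
Proof.
move=> ijn; rewrite /braid_A !expg2 !braid_inclM braid_inclV.
have -> : braid_incl (braid_A_conj n i j) = braid_A_conj n.+1 i j.
  rewrite /braid_A_conj (big_morph _ (@braid_inclM n) (braid_incl1 n)).
  apply: eq_big_seq => k; rewrite mem_rev mem_iota => kj.
  by rewrite braid_incl_sigma //; lia.
by rewrite braid_incl_sigma //; lia.
Qed.

(** Stated as an induction principle: it is used for subgroups on which two
    homomorphisms agree, or on which a character vanishes. *)
Theorem pure_braid_generated n (P : set (pure_braid n)) : is_subgroup P ->
  (forall i j, 0 < i < j -> j <= n -> P (pure_A n i j)) -> forall x, P x.
Proof.
elim: n P => [|n IHn] P PG PA x; have [P1 PM PV] := PG.
  suff -> : x = 1 by [].
  apply: val_inj; rewrite -(pres_class_repr (val x)).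
  by case: (repr (val x)) => // -[[i hi]]; exfalso; lia.
have [u [y [Uu ->]]] := pure_split x; apply: (PM).
  apply: subgroup_gen_sub Uu => // _ [k kn <-]; exact: PA.
suff: forall z, [set y | P (pure_incl y)]%classic z by apply.
apply: IHn => [|i j ij jn].
  split; first by rewrite /= (mulhom1 (@pure_inclM n)).
  - by move=> a b /= Pa Pb; rewrite pure_inclM; apply: PM.
  - by move=> a /= Pa; rewrite (mulhomV (@pure_inclM n)); apply: PV.
have -> : [set y | P (pure_incl y)]%classic (pure_A n i j) = P (pure_incl (pure_A n i j)) by [].
suff -> : pure_incl (pure_A n i j) = pure_A n.+1 i j by apply: PA => //; lia.
by apply: val_inj; apply: braid_incl_A; lia.
Qed.

(** * Cocycles on the braid groups *)

(** The permutational wreath product of G by the symmetric group acting on X.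
    A homomorphism to it over the symmetric group is the same as a 1-cocycle of
    the braid group with values in the functions from X to G.  The action is a
    phantom argument, so that the group law can be found from the type. *)
Definition wreath_product n (X : finType) (to : {action 'S_n &-> X})
  (G : groupType) : Type := ({ffun X -> G} * 'S_n)%type.

HB.instance Definition _ n (X : finType) (to : {action 'S_n &-> X})
  (G : groupType) := Choice.on (wreath_product to G).

Section Cocycle.
Variables (n : nat) (X : finType) (to : {action 'S_n &-> X}) (G : groupType).

Local Notation wreath := (wreath_product to G).
Implicit Types u v w : wreath.

Definition wreath_one : wreath := ([ffun=> 1], 1).
Definition wreath_mul u v : wreath :=
  ([ffun x => u.1 x * v.1 (to x u.2)], u.2 * v.2).
Definition wreath_inv u : wreath :=
  ([ffun x => (u.1 (to x u.2^-1))^-1], u.2^-1).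

Lemma wreath_mulA : associative wreath_mul.
Proof.
move=> u v w; congr (_, _); last exact: mulgA.
by apply/ffunP => x; rewrite !ffunE actM mulgA.
Qed.

Lemma wreath_mul1 : left_id wreath_one wreath_mul.
Proof.
move=> [f s]; congr (_, _); last exact: mul1g.
by apply/ffunP => x; rewrite !ffunE act1 mul1g.
Qed.

Lemma wreath_mulr1 : right_id wreath_one wreath_mul.
Proof.
move=> [f s]; congr (_, _); last exact: mulg1.
by apply/ffunP => x; rewrite !ffunE mulg1.
Qed.

Lemma wreath_mulV : left_inverse wreath_one wreath_inv wreath_mul.
Proof.
move=> u; congr (_, _); last exact: mulVg.
by apply/ffunP => x; rewrite !ffunE mulVg.
Qed.

Lemma wreath_mulrV : right_inverse wreath_one wreath_inv wreath_mul.
Proof.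
move=> u; congr (_, _); last exact: mulgV.
by apply/ffunP => x; rewrite !ffunE actK mulgV.
Qed.

HB.instance Definition _ := isGroup.Build wreath
  wreath_mulA wreath_mul1 wreath_mulr1 wreath_mulV wreath_mulrV.

Variable c : nat -> X -> G.

Definition wreath_gen (i : gen n) : wreath := ([ffun x => c (val i) x], gen_perm i).

Local Notation p i := (braid_perm (sigma n i)).

(* The two braid relations, read along the path of x. *)
Hypothesis c_comm : forall i j x, 0 < i -> i.+1 < j -> j < n ->
  c i x * c j (to x (p i)) = c j x * c i (to x (p j)).
Hypothesis c_braid : forall i x, 0 < i -> i.+1 < n ->
  c i x * c i.+1 (to x (p i)) * c i (to x (p i * p i.+1)) =
  c i.+1 x * c i (to x (p i.+1)) * c i.+1 (to x (p i.+1 * p i)).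

Lemma gen_perm_sigma (i : gen n) : gen_perm i = p (val i).
Proof.
case: i => i hi; rewrite (sigma_in hi) /braid_perm (pres_lift_class (@gen_perm_rel n)).
by rewrite /word_eval big_cons big_nil mulg1.
Qed.

Lemma wreath_gen_rel (u v : word (gen n)) :
  braid_rel u v -> word_eval wreath_gen u = word_eval wreath_gen v.
Proof.
move=> uv; have := gen_perm_rel uv.
case: uv => [] [i hi] [j hj] /= ij; rewrite /word_eval !big_cons !big_nil !mulg1 => E /=.
  congr (_, _) => //; apply/ffunP => x; rewrite !ffunE /= !gen_perm_sigma /=.
  by apply: c_comm => //; lia.
congr (_, _) => //; apply/ffunP => x; rewrite !ffunE /= !gen_perm_sigma /= -!actM ij !mulgA.
by apply: c_braid => //; lia.
Qed.

Definition cocycle (b : braid n) (x : X) : G := (pres_lift wreath_gen b).1 x.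

Lemma wreath_perm (b : braid n) : (pres_lift wreath_gen b).2 = braid_perm b.
Proof.
rewrite -(pres_class_repr b) (pres_lift_class wreath_gen_rel).
rewrite /braid_perm (pres_lift_class (@gen_perm_rel n)).
elim: (repr b) => [|[i e] u IHu]; rewrite /word_eval ?big_nil // !big_cons.
by congr (_ * _) => //; case: e.
Qed.

Lemma cocycleM b b' x : cocycle (b * b') x = cocycle b x * cocycle b' (to x (braid_perm b)).
Proof. by rewrite /cocycle (pres_liftM wreath_gen_rel) ffunE wreath_perm. Qed.

Lemma cocycle_sigma i x : 0 < i < n -> cocycle (sigma n i) x = c i x.
Proof.
move=> hi; rewrite (sigma_in hi) /cocycle (pres_lift_class wreath_gen_rel).
by rewrite /word_eval big_cons big_nil mulg1 ffunE.
Qed.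

Lemma cocycle1 x : cocycle 1 x = 1.
Proof. by rewrite /cocycle (pres_lift1 wreath_gen_rel) ffunE. Qed.

Lemma cocycleV b x : cocycle b^-1 x = (cocycle b (to x (braid_perm b)^-1))^-1.
Proof.
by apply/esym/mulg1_eq; rewrite -{2}[x](actKV to (braid_perm b)) -cocycleM mulgV cocycle1.
Qed.

(** The A_ij are iterated conjugates of squares of generators, so this formula
    is what computes cocycles on them. *)
Lemma cocycle_conj b b' x : braid_perm b' = 1 ->
  cocycle (b' ^ b^-1) x = cocycle b' (to x (braid_perm b)) ^ (cocycle b x)^-1.
Proof.
move=> pb'; rewrite !conjgE !invgK !cocycleM pb' act1.
by rewrite cocycleV actK.
Qed.

End Cocycle.

(** * Forgetting a strand *)

(** Conditions that contain conditionals themselves wait until their inner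
    conditional is resolved. *)
Ltac split_ifs :=
  repeat match goal with
  | |- context [if ?b then _ else _] =>
    lazymatch b with
    | context [if _ then _ else _] => fail
    | _ => let H := fresh "H" in case: (boolP b) => H; try lia
    end
  end.

Section Forget.
Variable n : nat.

(** What remains of a crossing of the positions i - 1 and i (counted from 0)
    when the strand that starts at position k is deleted. *)
Definition forget_sigma (i k : nat) : braid n :=
  if (k == i.-1) || (k == i) then 1 else
  if k < i then sigma n i.-1 else sigma n i.

Local Notation p i := (braid_perm (sigma n.+1 i)).

Lemma forget_sigma_comm i j (x : 'I_n.+1) : 0 < i -> i.+1 < j -> j < n.+1 ->
  forget_sigma i x * forget_sigma j (('P)%act x (p i)) =
  forget_sigma j x * forget_sigma i (('P)%act x (p j)).
Proof.
move=> i0 ij jn; rewrite /aperm /= !braid_perm_sigma; try lia.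
rewrite /forget_sigma; move: (nat_of_ord x) (ltn_ord x) => m mn.
split_ifs; rewrite ?mulg1 ?mul1g //; apply: sigma_comm; lia.
Qed.

Lemma forget_sigma_braid i (x : 'I_n.+1) : 0 < i -> i.+1 < n.+1 ->
  forget_sigma i x * forget_sigma i.+1 (('P)%act x (p i)) *
    forget_sigma i (('P)%act x (p i * p i.+1)) =
  forget_sigma i.+1 x * forget_sigma i (('P)%act x (p i.+1)) *
    forget_sigma i.+1 (('P)%act x (p i.+1 * p i)).
Proof.
move=> i0 iN; rewrite !actM /= /aperm /= !braid_perm_sigma; try lia.
rewrite /forget_sigma /=; move: (nat_of_ord x) (ltn_ord x) => m mn.
split_ifs; rewrite ?mulg1 ?mul1g //; last by apply: sigma_braid => //; lia.
by have := @sigma_braid n i.-1; rewrite prednK //; apply; lia.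
Qed.

(** Deleting a strand is a homomorphism only on pure braids.  On all braids it
    is a cocycle, since the position of the strand to be deleted moves. *)
Definition forget (k : 'I_n.+1) (b : braid n.+1) : braid n :=
  cocycle ('P)%act forget_sigma b k.

Lemma forgetM k b b' : forget k (b * b') = forget k b * forget (braid_perm b k) b'.
Proof. exact: (cocycleM forget_sigma_comm forget_sigma_braid). Qed.

Lemma forgetV k b : forget k b^-1 = (forget ((braid_perm b)^-1 k) b)^-1.
Proof. exact: (cocycleV forget_sigma_comm forget_sigma_braid). Qed.

Lemma forget_sigmaE k i : 0 < i < n.+1 -> forget k (sigma n.+1 i) = forget_sigma i k.
Proof. exact: (cocycle_sigma forget_sigma_comm forget_sigma_braid). Qed.

(** This makes the remaining braid of a pure braid pure. *)
Lemma braid_perm_forget k b :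
  braid_perm b = lift_perm k (braid_perm b k) (braid_perm (forget k b)).
Proof.
have step i (k' : 'I_n.+1) : 0 < i < n.+1 ->
    p i = lift_perm k' (p i k') (braid_perm (forget k' (sigma n.+1 i))).
  move=> hi; rewrite forget_sigmaE //; apply/permP => x.
  case: (unliftP k' x) => [y ->|->]; last by rewrite lift_perm_id.
  rewrite lift_perm_lift; apply: val_inj; rewrite /= !braid_perm_sigma //= /bump.
  have yn := ltn_ord y; have kn := ltn_ord k'; rewrite /forget_sigma.
  have [hk|hk] := boolP ((k' == i.-1 :> nat) || (k' == i :> nat)).
    by rewrite braid_perm1 perm1; split_ifs; lia.
  have [ki|ki] := ltnP k' i; rewrite !braid_perm_sigma; split_ifs; lia.
elim/braid_ind: b => [|b i hi IH|b i hi IH].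
- by rewrite /forget (cocycle1 forget_sigma_comm forget_sigma_braid) !braid_perm1 perm1 lift_perm1.
- by rewrite forgetM !braid_permM permM {1}IH {1}(step i (braid_perm b k)) // lift_permM.
- rewrite forgetM !braid_permM permM forgetV !braid_permV {1}IH.
  rewrite {1}(step i (((p i)^-1 (braid_perm b k)))) //.
  by rewrite permKV lift_permV lift_permM.
Qed.

Lemma forget_pure k (b : pure_braid n.+1) : forget k (val b) \in @pure n.
Proof.
have pb : braid_perm (val b) = 1 by apply/eqP; case: b.
have := braid_perm_forget k (val b); rewrite pb perm1 inE => /permP E.
apply/eqP/permP => i; have := E (lift k i).
by rewrite lift_perm_lift !perm1 => /lift_inj <-.
Qed.

Definition pure_forget k (b : pure_braid n.+1) : pure_braid n :=
  exist (fun b => b \in @pure n) (forget k (val b)) (forget_pure k b).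

Lemma pure_forgetM k : {morph pure_forget k : x y / x * y}.
Proof.
move=> x y; apply: val_inj => /=.
have px : braid_perm (val x) = 1 by apply/eqP; case: x.
by rewrite [LHS]forgetM px perm1.
Qed.

End Forget.

Lemma forget_conj n (k : 'I_n.+1) (b x : braid n.+1) : x \in @pure n.+1 ->
  forget k (x ^ b^-1) = forget (braid_perm b k) x ^ (forget k b)^-1.
Proof.
rewrite inE => /eqP.
exact: (cocycle_conj (@forget_sigma_comm n) (@forget_sigma_braid n)).
Qed.

(** The strands that survive are renumbered by [unbump].  Induction on j: A_i(j+1)
    is A_ij conjugated by sigma_j, which does or does not involve the strand
    k + 1 that is deleted. *)
Lemma forget_A n (k : 'I_n.+1) i j : 0 < i < j -> j <= n.+1 ->
  forget k (braid_A n.+1 i j) =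
    if (k.+1 == i) || (k.+1 == j) then 1
    else braid_A n (unbump k.+1 i) (unbump k.+1 j).
Proof.
move=> /andP[i0 ij] jn; rewrite /unbump.
elim: j ij jn k => // j IHj; rewrite ltnS leq_eqVlt => /predU1P[<-|ij] jn k.
  rewrite braid_A_adjacent expg2 forgetM !forget_sigmaE ?i0 //.
  rewrite /forget_sigma braid_perm_sigma ?i0 //.
  have [ki|ki] := boolP ((k.+1 == i) || (k.+1 == i.+1)).
    by split_ifs; rewrite ?mul1g.
  split_ifs; rewrite -expg2 -braid_A_adjacent; congr braid_A; lia.
have hj : 0 < j < n.+1 by lia.
rewrite braid_A_right // forget_conj ?braid_A_pure // IHj //; last by lia.
rewrite braid_perm_sigma // forget_sigmaE // /forget_sigma.
have Aj x y : y = x.+1 -> unbump k.+1 i < x ->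
    braid_A n (i - (k.+1 < i)) x ^ (sigma n x)^-1 = braid_A n (i - (k.+1 < i)) y.
  by move=> -> h; rewrite -braid_A_right.
rewrite /unbump in Aj.
have [kj|kj] := eqVneq (k : nat) j.-1.
  have -> : (j.+1 == i) || (j.+1 == j) = false by lia.
  have -> : (k.+1 == i) || (k.+1 == j.+1) = false by lia.
  by rewrite invg1 conjg1; congr braid_A; lia.
have [kj1|kj1] := eqVneq (k : nat) j.
  by rewrite prednK ?eqxx ?orbT ?conj1g //; [rewrite kj1 eqxx orbT|lia].
have [ki|ki] := eqVneq k.+1 i => /=; first by rewrite conj1g.
have -> : (k.+1 == j) = false by lia.
have -> : (k.+1 == j.+1) = false by lia.
have [kltj|jk] := ltnP k j.
  have -> : j - (k.+1 < j) = j.-1 by lia.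
  by apply: Aj; lia.
have -> : j - (k.+1 < j) = j by lia.
by apply: Aj; lia.
Qed.

Lemma pure_forget_A n (k : 'I_n.+1) i j : (0 < i < j)%N -> (j <= n.+1)%N ->
  pure_forget k (pure_A n.+1 i j) =
    if (k.+1 == i) || (k.+1 == j) then 1%g
    else pure_A n (unbump k.+1 i) (unbump k.+1 j).
Proof.
move=> ij jn; apply: val_inj; rewrite /= forget_A //.
by case: ifP.
Qed.

(** * The pure braid group on three strands is a free group of rank two times Z *)

(** The group F_2 x Z, presented by two free generators and the generator None,
    which commutes with both. *)
Inductive central_rel : word (option bool) -> word (option bool) -> Prop :=
  CentralRel g :
    central_rel [:: (None, false); (Some g, false)] [:: (Some g, false); (None, false)].

Definition F2Z : Type := pres central_rel.
HB.instance Definition _ := Group.on F2Z.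

(** Names of the elements that will correspond to the full twist z and to A_23,
    A_13, A_12: b, c and a, where the last is expressed through z = c b a. *)
Definition F2Z_z : F2Z := pres_gen central_rel None.
Definition F2Z_b : F2Z := pres_gen central_rel (Some true).
Definition F2Z_c : F2Z := pres_gen central_rel (Some false).
Definition F2Z_a : F2Z := (F2Z_c * F2Z_b)^-1 * F2Z_z.

Lemma F2Z_z_central x : commute F2Z_z x.
Proof.
have zg g : commute F2Z_z (pres_gen central_rel g).
  case: g => [g|] //; rewrite /commute [LHS]pres_class_cat [RHS]pres_class_cat.
  by apply/pres_classP/pres_eq_rel.
elim/pres_ind: x => [|y g IH|y g IH]; first exact: commute1.
- by apply: commuteM.
- by apply: commuteM => //; apply: commuteV.
Qed.

Section F2ZLift.
Variables (G : groupType) (z b c : G).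
Hypotheses (zb : commute z b) (zc : commute z c).

Definition F2Z_gen_image (g : option bool) : G :=
  if g is Some g' then if g' then b else c else z.

Lemma F2Z_gen_image_rel u v : central_rel u v ->
  word_eval F2Z_gen_image u = word_eval F2Z_gen_image v.
Proof. by case=> g; rewrite /word_eval !big_cons big_nil !mulg1; case: g. Qed.

Definition F2Z_lift : F2Z -> G := pres_lift F2Z_gen_image.

Lemma F2Z_liftM : {morph F2Z_lift : x y / x * y}.
Proof. exact: pres_liftM F2Z_gen_image_rel. Qed.

Lemma F2Z_lift_gen g : F2Z_lift (pres_gen central_rel g) = F2Z_gen_image g.
Proof.
rewrite /F2Z_lift (pres_lift_class F2Z_gen_image_rel).
by rewrite /word_eval big_cons big_nil mulg1.
Qed.

End F2ZLift.

(** Reidemeister-Schreier data for the subgroup P_3 of the braid group on three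
    strands, with the minimal positive braids as coset representatives.
    The braid T_s, followed by a crossing at position i of the strands x and y
    (x to the left), is again a representative if x < y; otherwise T_s is
    T sigma_i for the new representative T, and the Schreier generator is
    T sigma_i^2 T^-1.
    It is A_12 for the strands 0, 1 and A_23 for the strands 1, 2.  For the
    strands 0, 2 it depends on the side on which strand 1 is: A_13 if the
    crossing is at the left (i = 1), and A_13 conjugated by A_23 if i = 2. *)
Definition crossing (i x y : nat) : F2Z :=
  if x < y then 1 else
  if (y == 0%N) && (x == 1%N) then F2Z_a else
  if y == 1%N then F2Z_b else
  if i == 1%N then F2Z_c else F2Z_b^-1 * (F2Z_c * F2Z_b).

(** Three strands starting in the order x, y, w are reversed in the two possible
    ways; the identities that arise are the defining relations
    a c b = c b a = b a c of P_3. *)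
Lemma crossing_braid (x y w : 'I_3) : x != y -> x != w -> y != w ->
  crossing 1 x y * crossing 2 x w * crossing 1 y w =
  crossing 2 y w * crossing 1 x w * crossing 2 x y.
Proof.
move: x y w => [[|[|[|//]]] ?] [[|[|[|//]]] ?] [[|[|[|//]]] ?] //= _ _ _;
  rewrite /crossing /= ?mulg1 ?mul1g //.
- rewrite /F2Z_a -[RHS]mulgA mulVKg -mulgA F2Z_z_central mulgA.
  by rewrite invMg mulgVK.
- by rewrite mulVKg.
- by rewrite mulVKg /F2Z_a mulVKg -!mulgA F2Z_z_central mulKg.
Qed.

(** The inverse permutation tells which strand is at a given position. *)
Definition schreier_coef (i : nat) (s : 'S_3) : F2Z :=
  crossing i (s^-1 (inord i.-1)) (s^-1 (inord i)).

Local Notation p i := (braid_perm (sigma 3 i)).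

Lemma braid_perm_sigmaV n i (s : 'S_n) k :
  (s * braid_perm (sigma n i))^-1 k = s^-1 (braid_perm (sigma n i) k).
Proof.
suff pV : (braid_perm (sigma n i))^-1 = braid_perm (sigma n i).
  by rewrite invMg pV permM.
by apply: (mulgI (braid_perm (sigma n i))); rewrite mulgV -braid_permM -expg2 braid_perm_sigma2.
Qed.

Lemma perm_sigma3E : ((p 1 (inord 0) = inord 1) * (p 1 (inord 1) = inord 0) *
  (p 1 (inord 2) = inord 2) * (p 2 (inord 0) = inord 0) *
  (p 2 (inord 1) = inord 2) * (p 2 (inord 2) = inord 1))%type.
Proof. by do !split; apply: val_inj; rewrite /= braid_perm_sigma // !inordK. Qed.

Lemma schreier_comm i j (s : 'S_3) : 0 < i -> i.+1 < j -> j < 3 ->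
  schreier_coef i s * schreier_coef j ('R%act s (p i)) =
  schreier_coef j s * schreier_coef i ('R%act s (p j)).
Proof. lia. Qed.

Lemma schreier_braid i (s : 'S_3) : 0 < i -> i.+1 < 3 ->
  schreier_coef i s * schreier_coef i.+1 ('R%act s (p i)) *
    schreier_coef i ('R%act s (p i * p i.+1)) =
  schreier_coef i.+1 s * schreier_coef i ('R%act s (p i.+1)) *
    schreier_coef i.+1 ('R%act s (p i.+1 * p i)).
Proof.
case: i => [|[|//]] // _ _.
rewrite /= /schreier_coef !mulgA !braid_perm_sigmaV /= !perm_sigma3E.
by apply: crossing_braid; rewrite (inj_eq perm_inj) -val_eqE /= !inordK.
Qed.

Definition schreier_cocycle : braid 3 -> 'S_3 -> F2Z := cocycle ('R)%act schreier_coef.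

Definition F2Z_of_pure (x : pure_braid 3) : F2Z := schreier_cocycle (val x) 1.

Lemma F2Z_of_pureM : {morph F2Z_of_pure : x y / x * y}.
Proof.
move=> x y; have px : braid_perm (val x) = 1 by apply/eqP; case: x.
by rewrite /F2Z_of_pure /schreier_cocycle (cocycleM schreier_comm schreier_braid) px act1.
Qed.

Lemma schreier_cocycleM b b' s :
  schreier_cocycle (b * b') s = schreier_cocycle b s * schreier_cocycle b' (s * braid_perm b).
Proof. exact: (cocycleM schreier_comm schreier_braid). Qed.

Lemma schreier_cocycle_sigma i s : 0 < i < 3 ->
  schreier_cocycle (sigma 3 i) s = schreier_coef i s.
Proof. exact: (cocycle_sigma schreier_comm schreier_braid). Qed.

Lemma F2Z_of_pure_A : [/\ F2Z_of_pure (pure_A 3 1 2) = F2Z_a, F2Z_of_pure (pure_A 3 2 3) = F2Z_b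
  & F2Z_of_pure (pure_A 3 1 3) = F2Z_c].
Proof.
split.
- rewrite /F2Z_of_pure /= braid_A_adjacent expg2 !schreier_cocycleM !schreier_cocycle_sigma //.
  rewrite /schreier_coef !braid_perm_sigmaV invg1 /= !perm_sigma3E !perm1.
  by rewrite /crossing !inordK //= mul1g.
- rewrite /F2Z_of_pure /= braid_A_adjacent expg2 !schreier_cocycleM !schreier_cocycle_sigma //.
  rewrite /schreier_coef !braid_perm_sigmaV invg1 /= !perm_sigma3E !perm1.
  by rewrite /crossing !inordK //= mul1g.
rewrite /F2Z_of_pure /= braid_A_right // braid_A_adjacent expg2.
rewrite /schreier_cocycle (cocycle_conj schreier_comm schreier_braid); last first.
  by rewrite -expg2 braid_perm_sigma2.
rewrite -/schreier_cocycle schreier_cocycleM !schreier_cocycle_sigma // /= mul1g.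
rewrite /schreier_coef !braid_perm_sigmaV invg1 /= !perm_sigma3E !perm1.
rewrite -[p 2]mul1g !braid_perm_sigmaV.
by rewrite invg1 !perm_sigma3E !perm1 /crossing !inordK //= mul1g invg1 conjg1.
Qed.

Lemma pure_commute n (x y : pure_braid n) : commute (val x) (val y) -> commute x y.
Proof. by move=> xy; apply: val_inj. Qed.

Definition pure_z3 : pure_braid 3 := pure_A 3 1 3 * pure_A 3 2 3 * pure_A 3 1 2.

Lemma val_pure_z3 : val pure_z3 = (sigma 3 1 * sigma 3 2 * sigma 3 1) ^+ 2.
Proof.
rewrite -full_twistE; last exact: sigma_braid.
by rewrite /= braid_A_right // !braid_A_adjacent.
Qed.

Lemma pure_z3_comm x : commute pure_z3 x.
Proof.
have c1 : commute (val pure_z3) (sigma 3 1).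
  by rewrite val_pure_z3; apply: full_twist_comm_l; apply: sigma_braid.
have c2 : commute (val pure_z3) (sigma 3 2).
  by rewrite val_pure_z3; apply: full_twist_comm_r; apply: sigma_braid.
apply: pure_commute; elim/braid_ind: (val x) => [|b i hi IH|b i hi IH]; first exact: commute1.
all: apply: commuteM => //; try apply: commuteV.
all: by case: i hi => [|[|[|]]].
Qed.

Definition pure_of_F2Z : F2Z -> pure_braid 3 :=
  F2Z_lift pure_z3 (pure_A 3 2 3) (pure_A 3 1 3).

Lemma pure_of_F2ZM : {morph pure_of_F2Z : x y / x * y}.
Proof. by apply: F2Z_liftM; apply: pure_z3_comm. Qed.

Lemma pure_of_F2Z_gen g : pure_of_F2Z (pres_gen central_rel g) =
  F2Z_gen_image pure_z3 (pure_A 3 2 3) (pure_A 3 1 3) g.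
Proof. by apply: F2Z_lift_gen; apply: pure_z3_comm. Qed.

Lemma pure_of_F2ZK : cancel pure_of_F2Z F2Z_of_pure.
Proof.
move=> x; apply: (pres_hom_eq (f := F2Z_of_pure \o pure_of_F2Z) (g := id)) => [u v|u v|g] //=.
  by rewrite pure_of_F2ZM F2Z_of_pureM.
have [ra rb rc] := F2Z_of_pure_A.
rewrite pure_of_F2Z_gen; case: g => [[]|] //=.
by rewrite !F2Z_of_pureM ra rb rc /F2Z_a mulVKg.
Qed.

(** A comparison of homomorphisms on the A_ij, which generate P_3; by contrast the
    other composite lives on a group given by a presentation. *)
Lemma F2Z_of_pureK : cancel F2Z_of_pure pure_of_F2Z.
Proof.
have [ra rb rc] := F2Z_of_pure_A.
apply: pure_braid_generated => [|i j ij jn].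
  split=> [|x y /= Ex Ey|x /= Ex];
    first by rewrite /= (mulhom1 F2Z_of_pureM) (mulhom1 pure_of_F2ZM).
  - by rewrite F2Z_of_pureM pure_of_F2ZM Ex Ey.
  - by rewrite (mulhomV F2Z_of_pureM) (mulhomV pure_of_F2ZM) Ex.
case: i j ij jn => [|[|[|[|i]]]] [|[|[|[|j]]]] //= _ _.
- by rewrite ra /F2Z_a pure_of_F2ZM (mulhomV pure_of_F2ZM) pure_of_F2ZM !pure_of_F2Z_gen /= mulKg.
- by rewrite rc pure_of_F2Z_gen.
- by rewrite rb pure_of_F2Z_gen.
Qed.

(** For u = c this maps b to b c and fixes c and z. *)
Section Transvection.
Variable u : F2Z.

Definition transvection : F2Z -> F2Z := F2Z_lift F2Z_z (F2Z_b * u) F2Z_c.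

Lemma transvectionM : {morph transvection : x y / x * y}.
Proof. by apply: F2Z_liftM; apply: F2Z_z_central. Qed.

Lemma transvection_gen g :
  transvection (pres_gen central_rel g) = F2Z_gen_image F2Z_z (F2Z_b * u) F2Z_c g.
Proof. by apply: F2Z_lift_gen; apply: F2Z_z_central. Qed.

End Transvection.

Lemma transvectionK : cancel (transvection F2Z_c) (transvection F2Z_c^-1).
Proof.
move=> x; apply: (pres_hom_eq (f := transvection F2Z_c^-1 \o transvection F2Z_c)
  (g := id)) => [a b|a b|g] //=.
  by rewrite !transvectionM.
rewrite transvection_gen; case: g => [[]|] /=; rewrite ?transvection_gen //.
by rewrite transvectionM !transvection_gen /= mulgVK.
Qed.

Lemma transvectionVK : cancel (transvection F2Z_c^-1) (transvection F2Z_c).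
Proof.
move=> x; apply: (pres_hom_eq (f := transvection F2Z_c \o transvection F2Z_c^-1)
  (g := id)) => [a b|a b|g] //=.
  by rewrite !transvectionM.
rewrite transvection_gen; case: g => [[]|] /=; rewrite ?transvection_gen //.
by rewrite transvectionM (mulhomV (transvectionM F2Z_c)) !transvection_gen /= mulgK.
Qed.

Definition pure_transvection : pure_braid 3 -> pure_braid 3 :=
  pure_of_F2Z \o transvection F2Z_c \o F2Z_of_pure.

Lemma pure_transvectionM : {morph pure_transvection : x y / x * y}.
Proof. by move=> x y; rewrite /pure_transvection /= F2Z_of_pureM transvectionM pure_of_F2ZM. Qed.

HB.instance Definition _ :=
  isMultiplicative.Build (pure_braid 3) (pure_braid 3) pure_transvection pure_transvectionM.

Lemma pure_transvection_bij : bijective pure_transvection.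
Proof.
exists (pure_of_F2Z \o transvection F2Z_c^-1 \o F2Z_of_pure) => x;
  rewrite /pure_transvection /= pure_of_F2ZK.
  by rewrite transvectionK F2Z_of_pureK.
by rewrite transvectionVK F2Z_of_pureK.
Qed.

Lemma F2Z_of_pure_transvection x :
  F2Z_of_pure (pure_transvection x) = transvection F2Z_c (F2Z_of_pure x).
Proof. exact: pure_of_F2ZK. Qed.

(** * Pairs of characters that lift to the Heisenberg group *)

Section Heisenberg.
Variable R : comNzRingType.
Local Open Scope ring_scope.

(** Unipotent 3 x 3 matrices, by their entries (1,2), (2,3) and (1,3). *)
Definition heis : Type := (R * R * R)%type.
HB.instance Definition _ := Choice.on heis.

Definition heis_mul (u v : heis) : heis :=
  (u.1.1 + v.1.1, u.1.2 + v.1.2, u.2 + v.2 + u.1.1 * v.1.2).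
Definition heis_one : heis := (0, 0, 0).
Definition heis_inv (u : heis) : heis := (- u.1.1, - u.1.2, - u.2 + u.1.1 * u.1.2).

Lemma heis_mulA : associative heis_mul.
Proof. by move=> u v w; congr (_, _, _) => /=; ring. Qed.
Lemma heis_mul1 : left_id heis_one heis_mul.
Proof. by move=> [[a b] c]; congr (_, _, _) => /=; ring. Qed.
Lemma heis_mulr1 : right_id heis_one heis_mul.
Proof. by move=> [[a b] c]; congr (_, _, _) => /=; ring. Qed.
Lemma heis_mulV : left_inverse heis_one heis_inv heis_mul.
Proof. by move=> [[a b] c]; congr (_, _, _) => /=; ring. Qed.
Lemma heis_mulrV : right_inverse heis_one heis_inv heis_mul.
Proof. by move=> [[a b] c]; congr (_, _, _) => /=; ring. Qed.

HB.instance Definition _ := isGroup.Build heis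
  heis_mulA heis_mul1 heis_mulr1 heis_mulV heis_mulrV.

(** A pair of characters with a lift to this group sends commuting elements to
    proportional vectors, as the commutator pairing of the group is the
    determinant. *)
Lemma heis_commute (u v : heis) : commute u v -> u.1.1 * v.1.2 = v.1.1 * u.1.2.
Proof. by move=> /(congr1 snd) /=; rewrite [v.2 + _]addrC => /addrI. Qed.

End Heisenberg.

Section FourStrands.
Local Notation s := (sigma 4).
Local Notation A := (braid_A 4).

Lemma conj3_A12 : A 1 2 ^ (s 3)^-1 = A 1 2.
Proof.
rewrite braid_A_adjacent; apply/conjg_fixP/commgP/commuteV/commute_sym/commuteX.
exact/commute_sym/sigma_comm.
Qed.

Lemma conj1_A13 : A 1 3 ^ (s 1)^-1 = A 2 3.
Proof.
rewrite braid_A_right // !braid_A_adjacent -conjgM -invMg conjXg.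
by rewrite braid_conj2 //; apply: sigma_braid.
Qed.

(** The full twist of the strands 1, 2, 3 is central in their braid group.  The
    other triples follow by conjugation with sigma_3, sigma_2, sigma_1, which
    carries 123 to 124, 134 and 234. *)
Lemma triple_comm : [/\
  commute2 (A 1 3 * A 2 3 * A 1 2) (A 1 2) (A 1 3),
  commute2 (A 1 4 * A 2 4 * A 1 2) (A 1 2) (A 1 4),
  commute2 (A 1 4 * A 3 4 * A 1 3) (A 1 3) (A 1 4)
  & commute2 (A 2 4 * A 3 4 * A 2 3) (A 2 3) (A 2 4)].
Proof.
have E1 : commute2 (A 1 3 * A 2 3 * A 1 2) (A 1 2) (A 1 3).
  have b : s 1 * s 2 * s 1 = s 2 * s 1 * s 2 by apply: sigma_braid.
  rewrite braid_A_right // !braid_A_adjacent full_twistE //.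
  have c1 := full_twist_comm_l b; have c2 := full_twist_comm_r b.
  by split; [apply: commuteX|apply: commute_conj; [apply: commuteX|apply: commuteV]].
have E2 := commute2J (s 3)^-1 E1.
rewrite 2!conjMg conj3_A12 -!braid_A_right // in E2.
have E3 := commute2J (s 2)^-1 E2.
rewrite 2!conjMg -braid_A_right // (@conj_A_fix 3) // (@conj_A_up 3) // in E3.
have E4 := commute2J (s 1)^-1 E3.
rewrite 2!conjMg conj1_A13 (@conj_A_up 3) // (@conj_A_fix 3) // in E4.
Qed.

(** Conjugates of the commuting pair of A_12 and A_34 by sigma_2 and sigma_1; the
    extra conjugations do not matter for characters. *)
Lemma opposite_comm : [/\ commute (A 1 2) (A 3 4),
  commute (A 1 3) (A 2 4 ^ A 3 4) &
  commute (A 2 3) ((A 1 4 ^ A 2 4) ^ A 3 4)].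
Proof.
have E1 : commute (A 1 2) (A 3 4).
  by rewrite !braid_A_adjacent; apply: commuteX2; apply: sigma_comm.
have E2 := commuteJ (s 2)^-1 E1.
rewrite -braid_A_right // (@conj_A_down 3) // in E2.
have E3 := commuteJ (s 1)^-1 E2.
rewrite conjJg conj1_A13 (@conj_A_down 3) // (@conj_A_fix 3) // in E3.
Qed.

End FourStrands.

(** * Resonance modulo three *)

Section Resonance.
Local Open Scope nat_scope.

(** Vectors of F_3^2 are represented by pairs of natural numbers, so that the
    case analysis below can be computed. *)
Definition parallel (u v : nat * nat) : bool := u.1 * v.2 == u.2 * v.1 %[mod 3].

(** The condition coming from the full twist of three strands: the sum of the
    three vectors is proportional to each of them.  It is tested on two of them,
    which implies it for the third. *)
Definition triple_ok (u v w : nat * nat) : bool :=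
  let s := (u.1 + v.1 + w.1, u.2 + v.2 + w.2) in parallel u s && parallel v s.

(** The four coefficient vectors are the points of the projective line over F_3. *)
Definition dependent (s : seq (nat * nat)) : bool :=
  has (fun c => all (fun v => 3 %| c.1 * v.1 + c.2 * v.2) s)
    [:: (1, 0); (0, 1); (1, 1); (1, 2)].

(** The union of the five planes: four of them belong to the triples 123, 124,
    134 and 234, the fifth to the pairing of complementary edges. *)
Definition resonant (a12 a13 a23 a14 a24 a34 : nat) : bool :=
  [|| [&& a14 == 0, a24 == 0, a34 == 0 & 3 %| a12 + a13 + a23],
      [&& a13 == 0, a23 == 0, a34 == 0 & 3 %| a12 + a14 + a24],
      [&& a12 == 0, a23 == 0, a24 == 0 & 3 %| a13 + a14 + a34],
      [&& a12 == 0, a13 == 0, a14 == 0 & 3 %| a23 + a24 + a34]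
    | [&& a12 == a34, a13 == a24, a23 == a14 & 3 %| a12 + a13 + a23]].

Definition plane : seq (nat * nat) := [seq (x, y) | x <- iota 0 3, y <- iota 0 3].

Definition parallel_pairs : seq ((nat * nat) * (nat * nat)) :=
  [seq p <- [seq (u, v) | u <- plane, v <- plane] | parallel p.1 p.2].

Definition resonance_test (v12 v13 v23 v14 v24 v34 : nat * nat) : bool :=
  [&& triple_ok v12 v13 v23, triple_ok v12 v14 v24, triple_ok v13 v14 v34
    & triple_ok v23 v24 v34] ==>
  dependent [:: v12; v13; v23; v14; v24; v34] ||
  resonant v12.1 v13.1 v23.1 v14.1 v24.1 v34.1.

(** Choosing proportional vectors on complementary edges first leaves 33^3
    cases. *)
Lemma resonance_test_all :
  all (fun p => all (fun q => all (fun r =>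
    resonance_test p.1 q.1 r.1 r.2 q.2 p.2)
  parallel_pairs) parallel_pairs) parallel_pairs.
Proof. by vm_compute. Qed.

Lemma mem_parallel_pairs u v : u \in plane -> v \in plane -> parallel u v ->
  (u, v) \in parallel_pairs.
Proof. by move=> hu hv uv; rewrite mem_filter uv; apply: allpairs_f. Qed.

Lemma resonanceP v12 v13 v23 v14 v24 v34 :
    {subset [:: v12; v13; v23; v14; v24; v34] <= plane} ->
    [&& parallel v12 v34, parallel v13 v24 & parallel v23 v14] ->
    [&& triple_ok v12 v13 v23, triple_ok v12 v14 v24, triple_ok v13 v14 v34
      & triple_ok v23 v24 v34] ->
    ~~ dependent [:: v12; v13; v23; v14; v24; v34] ->
  resonant v12.1 v13.1 v23.1 v14.1 v24.1 v34.1.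
Proof.
move=> hv /and3P[p1 p2 p3] ht hd.
have mem v : v \in [:: v12; v13; v23; v14; v24; v34] -> v \in plane := @hv v.
have [h1 h2 h3] : [/\ (v12, v34) \in parallel_pairs,
    (v13, v24) \in parallel_pairs & (v23, v14) \in parallel_pairs].
  by split; apply: mem_parallel_pairs => //; apply: mem; rewrite !inE eqxx ?orbT.
have /allP/(_ _ h1)/allP/(_ _ h2)/allP/(_ _ h3) := resonance_test_all.
by rewrite /resonance_test /= ht (negbTE hd).
Qed.

(** The shift by 1 on the pairs 12, 13, 23 is the addition of
    x_12 + x_13 + x_23. *)
Lemma resonance_shift_all :
  all (fun a => all (fun b => all (fun c => all (fun d => all (fun e => all (fun f =>
    resonant a b c d e f ==>
    resonant ((a + 1) %% 3) ((b + 1) %% 3) ((c + 1) %% 3) d e f ==>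
    [&& d == 0, e == 0 & f == 0])
  (iota 0 3)) (iota 0 3)) (iota 0 3)) (iota 0 3)) (iota 0 3)) (iota 0 3).
Proof. by vm_compute. Qed.

Lemma resonance_shift a b c d e f :
    a < 3 -> b < 3 -> c < 3 -> d < 3 -> e < 3 -> f < 3 ->
    resonant a b c d e f ->
    resonant ((a + 1) %% 3) ((b + 1) %% 3) ((c + 1) %% 3) d e f ->
  [/\ d = 0, e = 0 & f = 0].
Proof.
move=> ha hb hc hd he hf r1 r2.
have I x : x < 3 -> x \in iota 0 3 by rewrite mem_iota.
have /allP/(_ a (I _ ha)) := resonance_shift_all.
move=> /allP/(_ b (I _ hb))/allP/(_ c (I _ hc))/allP/(_ d (I _ hd)).
move=> /allP/(_ e (I _ he))/allP/(_ f (I _ hf)).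
by rewrite r1 r2 => /and3P[/eqP-> /eqP-> /eqP->].
Qed.

End Resonance.

Lemma eq_Z3_nat (m n : nat) : (m%:R = n%:R :> 'Z_3)%R -> m = n %[mod 3].
Proof. by move=> /(congr1 val); rewrite /= !val_Zp_nat. Qed.

Lemma dvd3_Z3 (m : nat) : 3 %| m -> (m%:R = 0 :> 'Z_3)%R.
Proof. by move=> /eqP m0; apply: val_inj; rewrite /= val_Zp_nat. Qed.

Section PullBack.
Local Open Scope ring_scope.
Local Notation A := (pure_A 4).
Variable f : pure_braid 4 -> heis 'Z_3.
Hypothesis fM : {morph f : x y / (x * y)%g}.
Let a x : 'Z_3 := (f x).1.1.
Let b x : 'Z_3 := (f x).1.2.

Lemma heis_fst_char : additive_char a.
Proof. by move=> x y; rewrite /a fM. Qed.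

Lemma heis_snd_char : additive_char b.
Proof. by move=> x y; rewrite /b fM. Qed.

Lemma pure4_char0 (chi : pure_braid 4 -> 'Z_3) : additive_char chi ->
  [/\ chi (A 1 2) = 0, chi (A 1 3) = 0 & chi (A 2 3) = 0] ->
  [/\ chi (A 1 4) = 0, chi (A 2 4) = 0 & chi (A 3 4) = 0] -> forall x, chi x = 0.
Proof.
move=> chiM [h12 h13 h23] [h14 h24 h34].
apply: pure_braid_generated; first exact: char_ker_subgroup.
by move=> [|[|[|[|i]]]] [|[|[|[|[|j]]]]].
Qed.

(* The second coordinate comes first: it is the one whose resonance is
   concluded. *)
Let v x : nat * nat := (b x : nat, a x : nat).

Lemma commute_parallel x y : commute x y -> parallel (v x) (v y).
Proof.
move=> xy; apply/eqP/eq_Z3_nat; rewrite /= !natrM !natr_Zp.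
rewrite [LHS]mulrC; apply/esym/heis_commute.
by rewrite /commute -!fM xy.
Qed.

Lemma commute_parallel_sum x p q r : commute (p * q * r)%g x ->
  parallel (v x) ((v r).1 + (v p).1 + (v q).1, (v r).2 + (v p).2 + (v q).2)%N.
Proof.
move=> xy; apply/eqP/eq_Z3_nat; rewrite /= !natrM !natrD !natr_Zp.
have E : a (p * q * r)%g * b x = a x * b (p * q * r)%g.
  by apply: heis_commute; rewrite /commute -!fM xy.
rewrite !heis_fst_char !heis_snd_char in E.
by transitivity ((a p + a q + a r) * b x); [ring|rewrite E; ring].
Qed.

(** The elements g1 and g2 witness that the two characters are linearly
    independent. *)
Lemma pullback_resonant g1 g2 : (f g1).1 = (0, 1) -> (f g2).1 = (1, 0) ->
  resonant (b (A 1 2)) (b (A 1 3)) (b (A 2 3)) (b (A 1 4)) (b (A 2 4)) (b (A 3 4)).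
Proof.
move=> fg1 fg2.
have [c1 c2 c3] := opposite_comm; have [[t1 t2] [t3 t4] [t5 t6] [t7 t8]] := triple_comm.
have J x y : v (x ^ y)%g = v x.
  by rewrite /v (charJ heis_fst_char) (charJ heis_snd_char).
apply: (@resonanceP (v (A 1 2)) (v (A 1 3)) (v (A 2 3)) (v (A 1 4)) (v (A 2 4)) (v (A 3 4))).
- have P x : v x \in plane.
    by apply: allpairs_f; rewrite mem_iota /=; apply: ltn_ord.
  by move=> u; rewrite !in_cons in_nil orbF => /or4P[/eqP->|/eqP->|/eqP->|/or3P[]/eqP->]; apply: P.
- apply/and3P; split; first by apply: commute_parallel; apply: pure_commute; exact: c1.
    by rewrite -(J (A 2 4) (A 3 4)); apply: commute_parallel; apply: pure_commute; exact: c2.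
  rewrite -(J (A 1 4) (A 2 4)) -(J (A 1 4 ^ A 2 4)%g (A 3 4)).
  by apply: commute_parallel; apply: pure_commute; exact: c3.
- by apply/and4P; split; apply/andP; split; apply: commute_parallel_sum; apply: pure_commute.
apply/negP => /hasP[[m n] mn] /= /and5P[h12 h13 h23 h14 /and3P[h24 h34 _]].
pose chi x := m%:R * b x + n%:R * a x.
have chiM : additive_char chi.
  by move=> x y; rewrite /chi heis_fst_char heis_snd_char; ring.
have E x : (3 %| m * (b x : nat) + n * (a x : nat))%N -> chi x = 0.
  by move=> /dvd3_Z3; rewrite natrD !natrM !natr_Zp.
have chi0 : forall x, chi x = 0.
  by apply: pure4_char0 => //; split; apply: E.
have := chi0 g1; have := chi0 g2; rewrite /chi /a /b fg1 fg2 /=.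
rewrite !mulr0 !mulr1 add0r addr0.
by move: mn; rewrite !inE => /or4P[] /eqP[-> ->].
Qed.

End PullBack.

(** * The transvection does not lift *)

Section TestCharacters.
Local Open Scope ring_scope.
Local Notation heis3 := (heis 'Z_3).

(** In terms of characters of P_3, the first coordinate is x_23 - x_12 and the
    second is x_13 - x_12. *)
Definition F2Z_heis : F2Z -> heis3 :=
  F2Z_lift (G := heis3) 1%g ((1, 0, 0) : heis3) ((0, 1, 0) : heis3).

Lemma F2Z_heisM : {morph F2Z_heis : x y / (x * y)%g}.
Proof. by apply: F2Z_liftM; apply/commute_sym/commute1. Qed.

Lemma F2Z_heis_gen g : F2Z_heis (pres_gen central_rel g) =
  F2Z_gen_image (1%g : heis3) ((1, 0, 0) : heis3) ((0, 1, 0) : heis3) g.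
Proof. by apply: F2Z_lift_gen; apply/commute_sym/commute1. Qed.

Definition heis_forget (k : 'I_4) (x : pure_braid 4) : heis3 :=
  F2Z_heis (F2Z_of_pure (pure_forget k x)).

Lemma heis_forgetM k : {morph heis_forget k : x y / (x * y)%g}.
Proof. by move=> x y; rewrite /heis_forget pure_forgetM F2Z_of_pureM F2Z_heisM. Qed.

Lemma F2Z_heis_a : (F2Z_heis F2Z_a).1 = (-1, -1).
Proof.
rewrite /F2Z_a F2Z_heisM (mulhomV F2Z_heisM) F2Z_heisM !F2Z_heis_gen /=.
by congr (_, _); apply: val_inj.
Qed.

Lemma heis_forget_A (k : 'I_4) i j (x : 'Z_3 * 'Z_3) : (0 < i < j)%N -> (j <= 4)%N ->
  x = (if (k.+1 == i) || (k.+1 == j) then (0, 0) else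
       if unbump k.+1 j == 2 then (-1, -1) else
       if unbump k.+1 i == 2 then (1, 0) else (0, 1)) ->
  (heis_forget k (pure_A 4 i j)).1 = x.
Proof.
move=> ij j4 ->; rewrite /heis_forget pure_forget_A //; have [r12 r23 r13] := F2Z_of_pure_A.
case: ifP => [_|kij].
  by rewrite (mulhom1 F2Z_of_pureM) (mulhom1 F2Z_heisM).
move: kij; case: k => k k4 /=; rewrite /unbump.
case: k k4 => [|[|[|[|//]]]] _; case: i j ij j4 => [|[|[|[|i]]]] [|[|[|[|[|j]]]]] //= _ _ _;
  by rewrite ?r12 ?r23 ?r13 ?F2Z_heis_a ?F2Z_heis_gen.
Qed.

End TestCharacters.

Section NoLift.
Local Open Scope ring_scope.
Local Notation A := (pure_A 4).
(* Strands 2 and 3 are deleted; the second coordinates of h2 and h3 are then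
   x_14 - x_13 and x_14 - x_12, and d is x_13 - x_12. *)
Let h2 := heis_forget (inord 1).
Let h3 := heis_forget (inord 2).
Let d x : 'Z_3 := (h3 x).1.2 - (h2 x).1.2.

Let h2_A i j (x : 'Z_3 * 'Z_3) : (0 < i < j)%N -> (j <= 4)%N ->
  x = (if (2%N == i) || (2%N == j) then (0, 0) else
       if unbump 2 j == 2 then (-1, -1) else
       if unbump 2 i == 2 then (1, 0) else (0, 1)) -> (h2 (A i j)).1 = x.
Proof. by move=> ij j4 ->; apply: heis_forget_A => //; rewrite inordK. Qed.

Let h3_A i j (x : 'Z_3 * 'Z_3) : (0 < i < j)%N -> (j <= 4)%N ->
  x = (if (3%N == i) || (3%N == j) then (0, 0) else
       if unbump 3 j == 2 then (-1, -1) else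
       if unbump 3 i == 2 then (1, 0) else (0, 1)) -> (h3 (A i j)).1 = x.
Proof. by move=> ij j4 ->; apply: heis_forget_A => //; rewrite inordK. Qed.

Let d_char : additive_char d.
Proof.
move=> x y; rewrite /d (heis_snd_char (heis_forgetM _)) (heis_snd_char (heis_forgetM _)).
by rewrite opprD addrACA.
Qed.

Let d_last u : last_strand 3 u -> d u = 0.
Proof.
move=> Uu; suff : [set x | d x = 0]%classic u by [].
apply: subgroup_gen_sub Uu; first exact: char_ker_subgroup.
move=> _ [i i4 <-] /=; case: i i4 => [|[|[|[|i]]]] // _;
  rewrite /d (h2_A _ _ (erefl _)) // (h3_A _ _ (erefl _)) //=;
  by rewrite subrr.
Qed.

Let d_incl y : d (pure_incl y) = (F2Z_heis (F2Z_of_pure y)).1.2.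
Proof.
have [r12 r23 r13] := F2Z_of_pure_A.
pose e y := d (pure_incl y) - (F2Z_heis (F2Z_of_pure y)).1.2.
have eM : additive_char e.
  by move=> x z; rewrite /e pure_inclM F2Z_of_pureM F2Z_heisM d_char /= opprD addrACA.
apply/eqP; rewrite -subr_eq0 -/(e y); apply/eqP; move: y.
apply: pure_braid_generated; first exact: char_ker_subgroup.
have incl_A i j : (i < j <= 3)%N -> pure_incl (pure_A 3 i j) = A i j.
  by move=> ij; apply: val_inj; apply: braid_incl_A.
move=> [|[|[|[|i]]]] [|[|[|[|j]]]] //= _ _;
  rewrite /e incl_A // /d (h2_A _ _ (erefl _)) // (h3_A _ _ (erefl _)) //=;
  rewrite ?r12 ?r23 ?r13 ?F2Z_heis_a ?F2Z_heis_gen /=.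
all: by apply: val_inj.
Qed.

(** On A_12 the value is -2, which is 1 modulo 3. *)
Lemma transvection_snd :
  [/\ (F2Z_heis (transvection F2Z_c F2Z_a)).1.2 = 1,
      (F2Z_heis (transvection F2Z_c F2Z_b)).1.2 = 1
    & (F2Z_heis (transvection F2Z_c F2Z_c)).1.2 = 1].
Proof.
split; first last.
- by rewrite transvection_gen F2Z_heis_gen.
- by rewrite transvection_gen F2Z_heisM !F2Z_heis_gen; apply: val_inj.
rewrite /F2Z_a transvectionM (mulhomV (transvectionM F2Z_c)) transvectionM !transvection_gen /=.
rewrite !(F2Z_heisM, mulhomV F2Z_heisM) !F2Z_heis_gen.
by apply: val_inj.
Qed.

Lemma pure_transvection_not_liftable (Phi : pure_braid 4 -> pure_braid 4) :
  {morph Phi : x y / (x * y)%g} -> bijective Phi -> ~ induces Phi pure_transvection.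
Proof.
move=> PhiM [Psi _ PhiK] [PhiU Phiphi].
have f2M : {morph (h2 \o Phi) : x y / (x * y)%g}.
  by move=> x y; rewrite /= PhiM [LHS]heis_forgetM.
have f3M : {morph (h3 \o Phi) : x y / (x * y)%g}.
  by move=> x y; rewrite /= PhiM [LHS]heis_forgetM.
(* The independence of the pulled back pairs is witnessed by the preimages of
   generators that the original pairs separate. *)
have r2 := @pullback_resonant _ f2M (Psi (A 1 4)) (Psi (A 3 4)).
rewrite /= !PhiK (h2_A _ _ (erefl _)) // (h2_A _ _ (erefl _)) // in r2.
have {}r2 := r2 erefl erefl.
have r3 := @pullback_resonant _ f3M (Psi (A 1 4)) (Psi (A 2 4)).
rewrite /= !PhiK (h3_A _ _ (erefl _)) // (h3_A _ _ (erefl _)) // in r3.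
have {}r3 := r3 erefl erefl.
have last_d i : (0 < i < 4)%N -> (h3 (Phi (A i 4))).1.2 = (h2 (Phi (A i 4))).1.2.
  move=> i4; apply/eqP; rewrite -subr_eq0; apply/eqP/d_last.
  by rewrite -PhiU; exists (A i 4) => //; apply: mem_subgroup_gen; exists i.
have first_d x : d (Phi (pure_incl x)) = (F2Z_heis (transvection F2Z_c (F2Z_of_pure x))).1.2.
  rewrite -F2Z_of_pure_transvection -d_incl.
  have [U1 _ _] := subgroup_gen_subgroup
    [set pure_A 4 i 4 | i in [set i | (0 < i < 4)%N]]%classic.
  have : left_coset (last_strand 3) (pure_incl (pure_transvection x)) (Phi (pure_incl x)).
    by rewrite -Phiphi; exists 1%g => //; rewrite mulg1.
  by case=> u Uu <-; rewrite d_char (d_last Uu) addr0.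
have [tA tB tC] := transvection_snd; have [r12 r23 r13] := F2Z_of_pure_A.
have first3 i j : (0 < i < j)%N -> (j <= 3)%N ->
    (h3 (Phi (A i j))).1.2 = (h2 (Phi (A i j))).1.2 + 1.
  move=> ij j3; apply/eqP; rewrite addrC -subr_eq -/(d (Phi (A i j))).
  have -> : A i j = pure_incl (pure_A 3 i j).
    by apply/esym/val_inj/braid_incl_A; lia.
  rewrite first_d; case: i j ij j3 => [|[|[|[|i]]]] [|[|[|[|j]]]] //= _ _.
  - by rewrite r12 tA.
  - by rewrite r13 tC.
  - by rewrite r23 tB.
rewrite (last_d 1%N) // (last_d 2%N) // (last_d 3%N) // in r3.
rewrite (first3 1%N 2%N) // (first3 1%N 3%N) // (first3 2%N 3%N) // in r3.
have [||||||e14 e24 e34] := resonance_shift _ _ _ _ _ _ r2 r3; try exact: ltn_ord.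
(* So x_14 - x_13 would vanish on Phi U = U, but it is 1 on A_14. *)
have U0 u : last_strand 3 u -> (h2 (Phi u)).1.2 = 0.
  move=> Uu; suff : [set x | (h2 (Phi x)).1.2 = 0]%classic u by [].
  apply: subgroup_gen_sub Uu; first exact: (char_ker_subgroup (heis_snd_char f2M)).
  by move=> _ [i i4 <-] /=; case: i i4 => [|[|[|[|i]]]] // _; apply: val_inj.
have : last_strand 3 (A 1 4) by apply: mem_subgroup_gen; exists 1%N.
rewrite -PhiU => -[u /U0 u0 E]; move: u0; rewrite E (h2_A _ _ (erefl _)) //.
Qed.

End NoLift.

Theorem theorem5p1 :
  exists phi : {multiplicative pure_braid 3 -> pure_braid 3},
    bijective phi /\
    ~ exists Phi : {multiplicative pure_braid 4 -> pure_braid 4},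
        bijective Phi /\ induces Phi phi.
Proof.
exists pure_transvection; split; first exact: pure_transvection_bij.
by case=> Phi [Phi_bij]; apply: pure_transvection_not_liftable => //; apply: gmulfM.
Qed.
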